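(* Let $(\mathcal E,\mathcal L,\mathcal B)$ be a weakly left-resolving labelled space whose accommodating family $\mathcal B$ is closed under relative complements. Then there exists a representation of $C^*(\mathcal E,\mathcal L,\mathcal B)$ such that the image of $s_\alpha p_A s_\beta^*$ is not zero for all $(\alpha,A,\beta)\in S\setminus\{0\}$.
   Context: A directed graph $\mathcal E=(\mathcal E^0,\mathcal E^1,r,s)$ consists of non-empty sets of vertices and edges with range and source maps $r,s:\mathcal E^1\to\mathcal E^0$. A path is a finite or infinite sequence of edges $\lambda_1\lambda_2\cdots$ with $r(\lambda_i)=s(\lambda_{i+1})$; for finite $\lambda=\lambda_1\cdots\lambda_n$, $s(\lambda)=s(\lambda_1)$, $r(\lambda)=r(\lambda_n)$. Put $\mathcal E^0_{sink}=\{v:s^{-1}(v)=\emptyset\}$. A labelled graph $(\mathcal E,\mathcal L)$ is a graph with a surjective map $\mathcal L:\mathcal E^1\to\mathcal A$ onto a non-empty alphabet $\mathcal A$, extended letterwise to paths. $\mathcal L^{\ge 1}$ is the set of labels of finite paths of length at least $1$; $\mathcal L^*=\{\omega\}\cup\mathcal L^{\ge1}$ with $\omega$ the empty word. For $A\subseteq\mathcal E^0$ and $\alpha\in\mathcal L^{\ge1}$, $r(A,\alpha)=\{r(\lambda):\mathcal L(\lambda)=\alpha,\ s(\lambda)\in A\}$; $r(A,\omega)=A$; $r(\alpha)=r(\mathcal E^0,\alpha)$; $\mathcal L(A\mathcal E^1)=\{\mathcal L(e):e\in\mathcal E^1,\ s(e)\in A\}$. A labelled space $(\mathcal E,\mathcal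 L,\mathcal B)$ is a labelled graph with a family $\mathcal B$ of subsets of $\mathcal E^0$ that is accommodating: closed under finite intersections and finite unions, containing $r(\alpha)$ for all $\alpha\in\mathcal L^{\ge1}$, and with $r(A,\alpha)\in\mathcal B$ for all $A\in\mathcal B$, $\alpha\in\mathcal L^*$. It is weakly left-resolving if $r(A\cap B,\alpha)=r(A,\alpha)\cap r(B,\alpha)$ for all $A,B\in\mathcal B$, $\alpha\in\mathcal L^{\ge1}$. Closed under relative complements means $A\setminus B\in\mathcal B$ for $A,B\in\mathcal B$. For $\alpha\in\mathcal L^*$, $\mathcal B_\alpha=\{A\in\mathcal B:A\subseteq r(\alpha)\}$ (so $\mathcal B_\omega=\mathcal B$). $S=\{(\alpha,A,\beta):\alpha,\beta\in\mathcal L^*,\ A\in\mathcal B_\alpha\cap\mathcal B_\beta,\ A\ne\emptyset\}\cup\{0\}$. $C^*(\mathcal E,\mathcal L,\mathcal B)$ is the universal C*-algebra generated by projections $\{p_A:A\in\mathcal B\}$ and partial isometries $\{s_a:a\in\mathcal A\}$ subject to: (i) $p_{A\cap B}=p_Ap_B$, $p_{A\cup B}=p_A+p_B-p_{A\cap B}$, $p_\emptyset=0$ for $A,B\in\mathcal B$; (ii) $p_As_a=s_ap_{r(A,a)}$ for $A\in\mathcal B$, $a\in\mathcal A$; (iii) $s_a^*s_a=p_{r(a)}$ and $s_b^*s_a=0$ if $b\ne a$, for $a,b\in\mathcal A$; (iv) for every $A\in\mathcal B$ with $0<\#\mathcal L(A\mathcal E^1)<\infty$ and for which there is no $B\in\mathcal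 B$ with $\emptyset\ne B\subseteq A\cap\mathcal E^0_{sink}$, $p_A=\sum_{a\in\mathcal L(A\mathcal E^1)}s_ap_{r(A,a)}s_a^*$. For a word $\alpha=a_1\cdots a_n$, $s_\alpha=s_{a_1}\cdots s_{a_n}$; $s_\omega=1$ is a formal unit, so e.g. $s_\omega p_As_\omega^*$ means $p_A$. *)

(* Defs.v *)
From HB Require Import structures.
From mathcomp Require Import all_boot all_order all_algebra complex.
From mathcomp Require Import all_classical all_reals topology normedtype.

Set Implicit Arguments.
Unset Strict Implicit.
Unset Printing Implicit Defensive.

Import Order.TTheory GRing.Theory Num.Theory numFieldNormedType.Exports.

Local Open Scope classical_set_scope.
Local Open Scope ring_scope.

Record labelled_graph := LabelledGraph {
  vertex : Type;
  edge : Type;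
  letter : Type;
  range : edge -> vertex;
  source : edge -> vertex;
  label : edge -> letter;
  vertex_inhabited : inhabited vertex;
  edge_inhabited : inhabited edge;
  letter_inhabited : inhabited letter;
  label_surj : forall a, exists e, label e = a
}.

Section LabelledGraph.
Variable G : labelled_graph.
Implicit Types (A : set (vertex G)) (alpha beta : seq (letter G)).

(* The finite path of length [(size l).+1] with successive edges [e :: l];
   its source is [source e] and its range is [range (last e l)]. *)
Fixpoint is_path (e : edge G) (l : seq (edge G)) : Prop :=
  if l is f :: l' then range e = source f /\ is_path f l' else True.

(* The empty word omega is [::]. *)
Definition labels_ge1 : set (seq (letter G)) :=
  [set alpha | exists e l, is_path e l /\ map (@label G) (e :: l) = alpha].

Definition labels_star : set (seq (letter G)) := [set [::]] `|` labels_ge1.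

Definition rel_range A alpha : set (vertex G) :=
  if alpha is [::] then A else
  [set v | exists e l, [/\ is_path e l, map (@label G) (e :: l) = alpha,
                           A (source e) & range (last e l) = v]].

Definition word_range alpha : set (vertex G) := rel_range setT alpha.

Definition sinks : set (vertex G) := [set v | forall e, source e <> v].

Definition out_labels A : set (letter G) :=
  [set a | exists e, label e = a /\ A (source e)].

Record accommodating (B : set (set (vertex G))) : Prop := Accommodating {
  accommodatingI : forall A A', B A -> B A' -> B (A `&` A');
  accommodatingU : forall A A', B A -> B A' -> B (A `|` A');
  accommodating_word : forall alpha, labels_ge1 alpha -> B (word_range alpha);
  accommodating_range : forall A alpha,
    B A -> labels_star alpha -> B (rel_range A alpha)
}.

Definition weakly_left_resolving (B : set (set (vertex G))) : Prop :=
  forall A A' alpha, B A -> B A' -> labels_ge1 alpha ->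
    rel_range (A `&` A') alpha = rel_range A alpha `&` rel_range A' alpha.

Definition closed_rel_compl (B : set (set (vertex G))) : Prop :=
  forall A A', B A -> B A' -> B (A `\` A').

Definition family_below (B : set (set (vertex G))) alpha : set (set (vertex G)) :=
  [set A | B A /\ A `<=` word_range alpha].

(* The set S of triples; its zero element is [None].  As word_range [::] is
   the whole vertex set, the empty word puts no constraint on A. *)
Definition labelled_semigroup (B : set (set (vertex G))) :
    set (option (seq (letter G) * set (vertex G) * seq (letter G))) :=
  [set t | if t is Some (alpha, A, beta) then
             [/\ labels_star alpha, labels_star beta,
                 family_below B alpha A, family_below B beta A & A <> set0]
           else True].

End LabelledGraph.

(* The complex numbers are [R[i]].  There is no unit, so the ring structures
   of the library cannot be used. *)
HB.mixin Record CompleteNormedModule_isCstarAlgebra (R : realType) A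
    of CompleteNormedModule R[i] A := {
  cmul : A -> A -> A;
  cstar : A -> A;
  cmulA : associative cmul;
  cmulDl : left_distributive cmul +%R;
  cmulDr : right_distributive cmul +%R;
  cmulZl : forall (k : R[i]) (x y : A), cmul (k *: x) y = k *: cmul x y;
  cmulZr : forall (k : R[i]) (x y : A), cmul x (k *: y) = k *: cmul x y;
  ler_norm_cmul : forall x y : A, `|cmul x y| <= `|x| * `|y|;
  cstarK : involutive cstar;
  cstarD : {morph cstar : x y / x + y};
  cstarZ : forall (k : R[i]) (x : A), cstar (k *: x) = (k^*)%R *: cstar x;
  cstarM : forall x y : A, cstar (cmul x y) = cmul (cstar y) (cstar x);
  norm_cstar_cmul : forall x : A, `|cmul (cstar x) x| = `|x| ^+ 2
}.

#[short(type="cstarAlgType")]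
HB.structure Definition CstarAlgebra (R : realType) :=
  { A of CompleteNormedModule_isCstarAlgebra R A & CompleteNormedModule R[i] A }.

Section CstarAlgebra.
Variables (R : realType).

Definition is_projection (C : cstarAlgType R) (x : C) : Prop :=
  cstar x = x /\ cmul x x = x.

Definition is_partial_isometry (C : cstarAlgType R) (x : C) : Prop :=
  cmul (cmul x (cstar x)) x = x.

Definition is_star_hom (C D : cstarAlgType R) (phi : {linear C -> D}) : Prop :=
  (forall x y, phi (cmul x y) = cmul (phi x) (phi y)) /\
  (forall x, phi (cstar x) = cstar (phi x)).

End CstarAlgebra.

(* Hilbert spaces: the inner product is linear in its first argument and
   induces the norm. *)
HB.mixin Record CompleteNormedModule_isHilbert (R : realType) H
    of CompleteNormedModule R[i] H := {
  hdot : {dot H for (@Num.conj R[i])};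
  hdot_norm : forall x : H, hdot x x = `|x| ^+ 2
}.

#[short(type="hilbertType")]
HB.structure Definition Hilbert (R : realType) :=
  { H of CompleteNormedModule_isHilbert R H & CompleteNormedModule R[i] H }.

(* [pi] is a *-homomorphism from [C] to the bounded operators on [H]: for
   linear operators boundedness is continuity, and the third clause says that
   [pi (cstar a)] is the adjoint of [pi a]. *)
Record is_star_representation (R : realType) (C : cstarAlgType R)
    (H : hilbertType R) (pi : C -> {linear H -> H}) : Prop := {
  star_rep_bounded : forall a, continuous (pi a);
  star_rep_linear : forall (k : R[i]) a b x,
    pi (k *: a + b) x = k *: pi a x + pi b x;
  star_rep_mul : forall a b x, pi (cmul a b) x = pi a (pi b x);
  star_rep_adjoint : forall a x y,
    hdot (pi a x) y = hdot x (pi (cstar a) y)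
}.

Section UniversalAlgebra.
Variables (R : realType) (G : labelled_graph) (B : set (set (vertex G))).

(* The defining relations, for the generators p_A (A in B) and s_a.  Only the
   values of [p] on members of [B] matter. *)
Record satisfies_relations (C : cstarAlgType R)
    (p : set (vertex G) -> C) (s : letter G -> C) : Prop := {
  rel_proj : forall A, B A -> is_projection (p A);
  rel_piso : forall a, is_partial_isometry (s a);
  rel_cap : forall A A', B A -> B A' -> p (A `&` A') = cmul (p A) (p A');
  rel_cup : forall A A', B A -> B A' ->
    p (A `|` A') = p A + p A' - p (A `&` A');
  rel_empty : B set0 -> p set0 = 0;
  rel_comm : forall A a, B A -> cmul (p A) (s a) = cmul (s a) (p (rel_range A [:: a]));
  rel_source : forall a, cmul (cstar (s a)) (s a) = p (word_range [:: a]);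
  rel_orth : forall a b, b <> a -> cmul (cstar (s b)) (s a) = 0;
  rel_sum : forall A, B A -> out_labels A !=set0 -> finite_set (out_labels A) ->
    ~ (exists A', [/\ B A', A' !=set0 & A' `<=` A `&` sinks (G:=G)]) ->
    p A = \sum_(a \in (out_labels A : set {classic letter G}))
            cmul (cmul (s a) (p (rel_range A [:: a]))) (cstar (s a))
}.

(* [C], with generators [p] and [s], is the universal C*-algebra
   C*(E, L, B); uniqueness of [phi] encodes generation. *)
Definition is_universal_algebra (C : cstarAlgType R)
    (p : set (vertex G) -> C) (s : letter G -> C) : Prop :=
  satisfies_relations p s /\
  forall (D : cstarAlgType R) (q : set (vertex G) -> D) (t : letter G -> D),
    satisfies_relations q t ->
    let extends (phi : {linear C -> D}) :=
      [/\ is_star_hom phi, forall A, B A -> phi (p A) = q A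
        & forall a, phi (s a) = t a] in
    (exists phi, extends phi) /\
    (forall phi psi, extends phi -> extends psi -> phi =1 psi).

(* s_alpha p_A s_beta^*, associated so that no unit of [C] is needed: the
   factors s_omega are omitted. *)
Definition semigroup_elt (C : cstarAlgType R)
    (p : set (vertex G) -> C) (s : letter G -> C)
    (alpha : seq (letter G)) (A : set (vertex G)) (beta : seq (letter G)) : C :=
  foldr (fun a x => cmul (s a) x)
    (foldr (fun b x => cmul x (cstar (s b))) (p A) beta) alpha.

End UniversalAlgebra.

(* Main.v *)
Require Import Defs.
From HB Require Import structures.
From mathcomp Require Import all_boot all_order all_algebra complex finmap.
From mathcomp Require Import all_classical all_reals topology normedtype.
From mathcomp Require Import ereal esum ring lra.

Set Implicit Arguments.
Unset Strict Implicit.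
Unset Printing Implicit Defensive.

Import Order.TTheory GRing.Theory Num.Theory numFieldNormedType.Exports.

Local Open Scope classical_set_scope.
Local Open Scope ring_scope.
Local Open Scope complex_scope.

(** By the universal property it is enough to exhibit one C*-algebra of
    operators on a Hilbert space with elements [q A] and [t a] that satisfy
    the defining relations and for which no product [t_alpha q_A t_beta^*]
    with [(alpha, A, beta)] in [S] vanishes. The operators used here map each
    standard basis vector of the space [ell2 X] of square-summable functions
    on a set [X] of paths to another one or to zero.

    Vertices cannot serve as the points of [X]: weak left-resolution only
    makes [A |-> r(A, a)] compatible with intersections of members of [B]. The
    map is nevertheless a morphism of generalized Boolean algebras, and so it
    acts backwards on prime filters of [B], by [pull_filter]. A point of [X],
    a boundary path, is a finite or infinite chain of prime filters [F_0, F_1,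
    ...] and letters [a_1, a_2, ...] in which [F_(i+1)] contains [r(a_(i+1))]
    and [F_i] is the pull-back of [F_(i+1)] along [a_(i+1)]; the chain may end
    only at a filter none of whose members is regular, that is, subject to the
    summation relation. Then [q A] is the projection onto the paths with [A]
    in [F_0], and [t a] prepends the letter [a]. All relations are pointwise
    statements about paths ([boundary_relations]); the summation relation
    holds because a path whose first filter has a regular member must go on
    ([cylinder_regular]).

    The relations would hold trivially if there were no paths. Every nonempty
    [A] in [B] is met by a path ([cylinder_nonempty]) because a chain that is
    not allowed to end can be prolonged: [regular_step] finds the next letter
    by a finiteness argument and the next prime filter by the ultrafilter
    lemma. If [x] is a path with [A] in [F_0], then [alpha x] and [beta x] are
    paths too, because [A] lies in [r(alpha)] and in [r(beta)], and [t_alpha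
    q_A t_beta^*] maps the basis vector at [beta x] to the one at [alpha x],
    which is not zero ([semigroup_elt_neq0]).

    The analytic part provides the two objects that the argument lives in: the
    C*-algebra of bounded operators with an adjoint on an arbitrary Hilbert
    space, and the Hilbert space [ell2 X] for an arbitrary set [X]. *)

(** * Inner products *)

(** A pointwise limit [l] of a Cauchy filter is its norm limit as soon as
    every bound that the filter puts on the distance to a point [x0] passes to
    the distance from [x0] to [l]; this is how lower semicontinuity of the
    norm turns pointwise limits into completeness, below for operators and for
    square-summable functions. *)
Lemma cvg_of_ball_limit (K : numFieldType) (V : normedModType K)
    (F : set_system V) (l : V) : ProperFilter F -> cauchy F ->
  (forall (e : K) x0, 0 < e -> F (ball x0 e) -> `|x0 - l| <= e) -> cvg F.
Proof.
move=> FF /cauchyP Fc Fl; apply/cvg_ex; exists l.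
apply/cvgrPdist_le => e e0; have e2 : 0 < e / 2 by rewrite divr_gt0.
have [x0 Fx0] := Fc _ e2; apply: filterS (Fx0) => y.
rewrite -ball_normE /ball_/= => x0y.
rewrite (splitr e) (le_trans (ler_distD x0 _ _))// lerD//; last exact: ltW.
by rewrite distrC Fl.
Qed.

Section DotProduct.
Variables (K : numClosedFieldType) (U : lmodType K)
  (form : {dot U for (@Num.conj K)}).
Implicit Types x y : U.

Lemma dot_cauchy_schwarz x y :
  `|form x y| <= sqrtC (form x x) * sqrtC (form y y).
Proof.
rewrite -(@ler_pXn2r _ 2) ?nnegrE ?mulr_ge0 ?sqrtC_ge0 ?dnorm_ge0//.
rewrite exprMn !sqrtCK; have [->|y0] := eqVneq y 0.
  by rewrite !linear0r normr0 expr0n mulr0.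
set n := form y y; set d := form x y.
have n0 : 0 < n by rewrite dnorm_gt0.
have nR : n^*%R = n by apply/CrealP/ger0_real/ltW.
(* [n *: x - d *: y] is [n] times the component of [x] orthogonal to [y]. *)
have : 0 <= form (n *: x - d *: y) (n *: x - d *: y) by exact: dnorm_ge0.
rewrite linearBl !linearBr !linearZl_LR !linearZr_LR /= -/n -/d.
rewrite [form y x]hermC /= mul1r -/d nR normCK.
move=> h; rewrite -subr_ge0 -(pmulr_rge0 _ n0).
by move: h; congr (is_true (0 <= _)); ring.
Qed.

Lemma sqrt_dnormD x y :
  sqrtC (form (x + y) (x + y)) <= sqrtC (form x x) + sqrtC (form y y).
Proof.
rewrite -(@ler_pXn2r _ 2) ?nnegrE ?addr_ge0 ?sqrtC_ge0 ?dnorm_ge0//.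
rewrite sqrrD !sqrtCK dnormD addrAC lerD2r lerD2l.
apply: le_trans (real_ler_norm _) _.
  by apply/CrealP; rewrite rmorphD /= conjCK addrC.
rewrite (le_trans (ler_normD _ _))// norm_conjC -mulr2n lerMn2r.
exact: dot_cauchy_schwarz.
Qed.

Lemma sqrt_dnormZ (k : K) x :
  sqrtC (form (k *: x) (k *: x)) = `|k| * sqrtC (form x x).
Proof. by rewrite dnormZ rootCMl ?exprn_ge0// sqrCK. Qed.

End DotProduct.

Section Hilbert.
Variables (R : realType) (H : hilbertType R).
Implicit Types (x y z : H) (f g : H -> H).

Lemma hdotC x y : hdot x y = (hdot y x)^*%R.
Proof. by rewrite hermC /= mul1r. Qed.

Lemma hdotDl x y z : hdot (x + y) z = hdot x z + hdot y z.
Proof. exact: linearDl. Qed.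
Lemma hdotDr x y z : hdot z (x + y) = hdot z x + hdot z y.
Proof. exact: linearDr. Qed.
Lemma hdotZl (k : R[i]) x z : hdot (k *: x) z = k * hdot x z.
Proof. exact: linearZl_LR. Qed.
Lemma hdotZr (k : R[i]) x z : hdot z (k *: x) = k^*%R * hdot z x.
Proof. exact: linearZr_LR. Qed.
Lemma hdotBl x y z : hdot (x - y) z = hdot x z - hdot y z.
Proof. exact: linearBl. Qed.
Lemma hdotBr x y z : hdot z (x - y) = hdot z x - hdot z y.
Proof. exact: linearBr. Qed.

Lemma hdot_inj x y : (forall z, hdot x z = hdot y z) -> x = y.
Proof.
move=> xy; apply/eqP; rewrite -subr_eq0 -normr_eq0 -sqrf_eq0.
by rewrite -hdot_norm hdotBl xy subrr.
Qed.

Lemma hdot_injr x y : (forall z, hdot z x = hdot z y) -> x = y.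
Proof. by move=> xy; apply: hdot_inj => z; rewrite hdotC xy -hdotC. Qed.

Lemma cauchy_schwarz x y : `|hdot x y| <= `|x| * `|y|.
Proof.
by rewrite (le_trans (dot_cauchy_schwarz _ _ _))// !hdot_norm !sqrCK.
Qed.

End Hilbert.

(** * The C*-algebra of adjointable operators on a Hilbert space *)

Section Adjointable.
Variables (R : realType) (H : hilbertType R).
Implicit Types (x y z : H) (f g : H -> H).

Definition is_adjoint f g := forall x y, hdot (f x) y = hdot x (g y).

Definition op_bound f (M : R[i]) := 0 <= M /\ forall x, `|f x| <= M * `|x|.

(** Members are bare functions: linearity follows from the existence of an
    adjoint, because the inner product is nondegenerate. Having an adjoint is
    part of the definition, where one could instead derive it from boundedness
    and linearity by the Riesz representation theorem. *)
Definition bounded_adjointable : {pred H -> H} :=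
  mem [set f | (exists g, is_adjoint f g) /\ (exists M, op_bound f M)].

Lemma is_adjoint_sym f g : is_adjoint f g -> is_adjoint g f.
Proof. by move=> fg x y; rewrite hdotC -fg -hdotC. Qed.

(** Cauchy-Schwarz for [`|g y| ^+ 2 = hdot (f (g y)) y]. *)
Lemma adjoint_bound f g (M : R[i]) :
  is_adjoint f g -> op_bound f M -> op_bound g M.
Proof.
move=> fg [M0 fM]; split=> // y; have [->|gy0] := eqVneq (g y) 0.
  by rewrite normr0 mulr_ge0.
rewrite -(@ler_pM2r _ `|g y|) ?normr_gt0// -expr2 -hdot_norm -fg.
apply: le_trans (real_ler_norm _) _.
  by rewrite fg hdot_norm ger0_real// exprn_ge0.
by rewrite (le_trans (cauchy_schwarz _ _))// mulrAC ler_wpM2r.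
Qed.

Lemma bounded_adjointable_submod : submod_closed bounded_adjointable.
Proof.
split=> [|k f f']; rewrite !inE/=.
  split; first by exists 0 => x y; rewrite linear0l linear0r.
  by exists 0; split=> // x; rewrite normr0 mul0r.
move=> [[g fg] [M [M0 fM]]] [[g' fg'] [M' [M'0 fM']]]; split.
  exists (k^*%R *: g + g') => x y.
  rewrite !fctE hdotDl hdotDr hdotZl hdotZr conjCK fg fg'//.
exists (`|k| * M + M'); split=> [|x]; first by rewrite addr_ge0// mulr_ge0.
rewrite !fctE (le_trans (ler_normD _ _))// normrZ mulrDl lerD// -mulrA.
by rewrite ler_wpM2l.
Qed.

HB.instance Definition _ :=
  GRing.isSubmodClosed.Build _ _ bounded_adjointable bounded_adjointable_submod.

Record bounded_op := BoundedOp { bop_fun :> H -> H;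
  bop_adjointable : bop_fun \in bounded_adjointable }.

HB.instance Definition _ := [isSub for bop_fun].
HB.instance Definition _ := [Choice of bounded_op by <:].
HB.instance Definition _ := [SubChoice_isSubLmodule of bounded_op by <:].

Implicit Types (S T : bounded_op).

Lemma bop_ext S T : S =1 T -> S = T.
Proof. by move=> ST; apply: val_inj; apply/funext. Qed.

Lemma bop_adjoint_ex T : exists S : bounded_op, is_adjoint T S.
Proof.
have := bop_adjointable T; rewrite inE/= => -[[g fg] [M TM]].
suff gP : g \in bounded_adjointable by exists (BoundedOp gP).
rewrite inE/=; split; first by exists T; exact: is_adjoint_sym.
by exists M; exact: adjoint_bound TM.
Qed.

Definition adj T : bounded_op := projT1 (cid (bop_adjoint_ex T)).

Lemma adjP T : is_adjoint T (adj T).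
Proof. exact: projT2 (cid (bop_adjoint_ex T)). Qed.

Lemma adj_unique S T : is_adjoint T S -> adj T = S.
Proof.
by move=> TS; apply: bop_ext => y; apply: hdot_injr => x; rewrite -adjP TS.
Qed.

Lemma bop_linear T : linear T.
Proof.
move=> k x y; apply: hdot_inj => z.
by rewrite adjP !hdotDl !hdotZl -!adjP.
Qed.

HB.instance Definition _ T :=
  @GRing.isLinear.Build _ _ _ _ (bop_fun T) (bop_linear T).

Lemma bop_bound T : exists M : R[i], op_bound T M.
Proof. by have := bop_adjointable T; rewrite inE/= => -[]. Qed.

Definition op_bounds T := [set M : R | op_bound T M%:C].

(** The infimum is taken in [R], where it exists, and then seen in [R[i]],
    where norms take their values. *)
Definition op_norm T : R[i] := (inf (op_bounds T))%:C.

Lemma op_bounds_inf T : has_inf (op_bounds T).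
Proof.
split.
  have [M MT] := bop_bound T; exists (complex.Re M).
  rewrite /op_bounds /= RRe_real//.
  by case: MT => /ger0_real.
by exists 0 => M [/= + _]; rewrite ler0c.
Qed.

Lemma op_norm_ge0 T : 0 <= op_norm T.
Proof.
rewrite /op_norm ler0c; apply: lb_le_inf; first by case: (op_bounds_inf T).
by move=> M [/= + _]; rewrite ler0c.
Qed.

Lemma op_norm_le T (M : R[i]) : op_bound T M -> op_norm T <= M.
Proof.
move=> MT; have MR : M \is Num.real by case: MT => /ger0_real.
rewrite -(RRe_real MR) lecR; apply: ge_inf; first by case: (op_bounds_inf T).
by rewrite /op_bounds/= RRe_real.
Qed.

Lemma op_normP T : op_bound T (op_norm T).
Proof.
split=> [|x]; first exact: op_norm_ge0.
have [->|x0] := eqVneq x 0; first by rewrite linear0 !normr0 mulr0.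
have nx0 : 0 < `|x| by rewrite normr_gt0.
rewrite -ler_pdivrMr//.
have qR : `|T x| / `|x| \is Num.real by rewrite ger0_real// divr_ge0.
rewrite -(RRe_real qR) lecR; apply: lb_le_inf; first by case: (op_bounds_inf T).
by move=> M [/= _ /(_ x)]; rewrite -ler_pdivrMr// -(RRe_real qR) lecR.
Qed.

Lemma op_norm_bound T x : `|T x| <= op_norm T * `|x|.
Proof. by case: (op_normP T). Qed.

Lemma op_normD S T : op_norm (S + T) <= op_norm S + op_norm T.
Proof.
apply: op_norm_le; split=> [|x]; first by rewrite addr_ge0 ?op_norm_ge0.
by rewrite mulrDl (le_trans (ler_normD _ _))// lerD ?op_norm_bound.
Qed.

Lemma op_norm_scale_le (k : R[i]) T : op_norm (k *: T) <= `|k| * op_norm T.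
Proof.
apply: op_norm_le; split=> [|x]; first by rewrite mulr_ge0 ?op_norm_ge0.
by rewrite normrZ -mulrA ler_wpM2l// op_norm_bound.
Qed.

Lemma op_norm_eq0 T : op_norm T = 0 -> T = 0.
Proof.
move=> T0; apply: bop_ext => x; apply/eqP.
by rewrite -normr_le0; have := op_norm_bound T x; rewrite T0 mul0r.
Qed.

Lemma op_normZ (k : R[i]) T : op_norm (k *: T) = `|k| * op_norm T.
Proof.
apply/eqP; rewrite eq_le op_norm_scale_le/=.
have [->|k0] := eqVneq k 0; first by rewrite normr0 mul0r op_norm_ge0.
rewrite -ler_pdivlMl ?normr_gt0// -normfV.
by rewrite -[in leLHS](scalerK k0 T) op_norm_scale_le.
Qed.

HB.instance Definition _ := Lmodule_isNormed.Build R[i] bounded_op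
  op_normD op_normZ op_norm_eq0.

Lemma bop_norm_bound T x : `|T x| <= `|T| * `|x|.
Proof. exact: op_norm_bound. Qed.

Lemma adjK : involutive adj.
Proof. by move=> T; apply/adj_unique/is_adjoint_sym/adjP. Qed.

Lemma adjD : {morph adj : S T / S + T}.
Proof.
by move=> S T; apply: adj_unique => x y; rewrite hdotDl !adjP -hdotDr.
Qed.

Lemma adjZ (k : R[i]) T : adj (k *: T) = k^*%R *: adj T.
Proof.
apply: adj_unique => x y; rewrite -[LHS]/(hdot (k *: T x) y).
by rewrite -[RHS]/(hdot x (k^*%R *: adj T y)) hdotZl hdotZr conjCK adjP.
Qed.

Lemma op_norm_adj T : `|adj T| = `|T|.
Proof.
have le S : `|adj S| <= `|S|.
    exact/op_norm_le/(adjoint_bound (adjP S))/op_normP.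
by apply/eqP; rewrite eq_le le -[in leLHS](adjK T) le.
Qed.

(** Along a Cauchy filter of operators [T] the values [phi T x] converge, with
    a rate proportional to [`|x|]. The lemma is used for the identity and for
    the adjoint: having the limits of [T x] and of [adj T x] at the same time
    is what makes the limit operator adjointable. *)
Lemma bop_cauchy_pointwise (F : set_system bounded_op)
    (phi : {additive bounded_op -> bounded_op}) :
    ProperFilter F -> cauchy F -> (forall S, `|phi S| = `|S|) ->
  {g : H -> H | forall (e : R[i]) T, 0 < e -> F (ball T e) ->
    forall x, `|phi T x - g x| <= e * `|x|}.
Proof.
move=> FF /cauchyP Fc phi_norm.
have phiB S T x : `|phi S x - phi T x| <= `|S - T| * `|x|.
  by rewrite -phi_norm raddfB; exact: (bop_norm_bound (phi S - phi T)).
have cvgF x : cvg ((fun T : bounded_op => phi T x) @ F).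
  apply: cauchy_cvg; apply/cauchyP => e e0.
  have d0 : 0 < e / (`|x| + 1) by rewrite divr_gt0// ltr_wpDl.
  have [T FT] := Fc _ d0; exists (phi T x).
  suff: F [set S | ball (phi T x : H) e (phi S x)] by [].
  apply: filterS FT => S /=.
  rewrite -!ball_normE /ball_/= => TS.
  rewrite (le_lt_trans (phiB _ _ _))//.
  rewrite ltr_pdivlMr ?ltr_wpDl// in TS; apply: le_lt_trans TS.
  by rewrite ler_wpM2l// lerDl.
exists (fun x => lim ((fun T : bounded_op => phi T x) @ F)) => e T e0 FT x.
apply/ler_addgt0Pr => d d0.
have /cvgrPdist_le /(_ _ d0) Fd := cvgF x.
have [S [TS Sd]] := filter_ex (filterI FT Fd).
rewrite (le_trans (ler_distD (phi S x) _ _))// lerD//; last by rewrite distrC.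
rewrite (le_trans (phiB _ _ _))// ler_wpM2r// ltW//.
Qed.

Lemma adj_zmod_morphism : zmod_morphism adj.
Proof. by move=> S T; rewrite adjD -scaleN1r adjZ rmorphN1 scaleN1r. Qed.

HB.instance Definition _ :=
  GRing.isZmodMorphism.Build bounded_op bounded_op adj adj_zmod_morphism.

Lemma bop_complete (F : set_system bounded_op) :
  ProperFilter F -> cauchy F -> cvg F.
Proof.
move=> FF Fc; have /cauchyP Fe := Fc.
have [f fF] := bop_cauchy_pointwise (phi := idfun) FF Fc (fun=> erefl).
have [g gF] := bop_cauchy_pointwise FF Fc op_norm_adj.
have fg : is_adjoint f g.
  move=> x y; apply/eqP; rewrite -subr_eq0 -normr_le0.
  apply/ler_addgt0Pr => e e0.
  rewrite add0r; pose c := `|x| * `|y| *+ 2 + 1.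
  have c0 : 0 < c by rewrite ltr_wpDl// mulrn_wge0// mulr_ge0.
  have d0 : 0 < e / c by rewrite divr_gt0.
  have [T FT] := Fe _ d0.
  (* Both [f] and [g] are compared with one operator [T] of the filter and
     with its adjoint, for which the two sides agree. *)
  have -> : hdot (f x) y - hdot x (g y) =
      hdot x (adj T y - g y) - hdot (T x - f x) y.
    by rewrite hdotBr hdotBl -adjP; ring.
  rewrite (le_trans (ler_normB _ _))//.
  have le1 : `|hdot x (adj T y - g y)| <= `|x| * (e / c * `|y|).
    by rewrite (le_trans (cauchy_schwarz _ _))// ler_wpM2l// gF.
  have le2 : `|hdot (T x - f x) y| <= e / c * `|x| * `|y|.
    by rewrite (le_trans (cauchy_schwarz _ _))// ler_wpM2r// fF.
  apply: le_trans (lerD le1 le2) _.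
  rewrite -[leRHS](divfK (lt0r_neq0 c0)); move: (e / c) d0 => d d0.
  suff -> : d * c = `|x| * (d * `|y|) + d * `|x| * `|y| + d.
    by rewrite lerDl ltW.
  by rewrite /c; ring.
have fb : f \in bounded_adjointable.
  rewrite inE/=; split; first by exists g.
  have [T FT] := Fe _ ltr01; exists (`|T| + 1); split=> [|x].
    by rewrite addr_ge0.
  rewrite -[f x](subKr (T x)) (le_trans (ler_normB _ _))// mulrDl.
  by rewrite lerD ?bop_norm_bound// fF.
apply: (@cvg_of_ball_limit _ _ _ (BoundedOp fb)) => // e T e0 FT.
by apply: op_norm_le; split=> [|x]; [exact: ltW|exact: fF].
Qed.

HB.instance Definition _ := Uniform_isComplete.Build bounded_op bop_complete.

Lemma comp_bounded_adjointable S T : S \o T \in bounded_adjointable.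
Proof.
rewrite inE/=; split.
  by exists (adj T \o adj S) => x y; rewrite /= !adjP.
exists (`|S| * `|T|); split=> [|x]; first by rewrite mulr_ge0.
apply: le_trans (bop_norm_bound S (T x)) _.
by rewrite -mulrA ler_wpM2l//; exact: bop_norm_bound.
Qed.

Definition bop_mul S T : bounded_op := BoundedOp (comp_bounded_adjointable S T).

Lemma adjM S T : adj (bop_mul S T) = bop_mul (adj T) (adj S).
Proof. by apply: adj_unique => x y; rewrite /= !adjP. Qed.

Lemma op_normM S T : `|bop_mul S T| <= `|S| * `|T|.
Proof.
apply: op_norm_le; split=> [|x]; first by rewrite mulr_ge0.
apply: le_trans (bop_norm_bound S (T x)) _.
by rewrite -mulrA ler_wpM2l//; exact: bop_norm_bound.
Qed.

(** The lower bound is Cauchy-Schwarz for [`|T x| ^+ 2 = hdot x (adj T (T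
    x))]. *)
Lemma op_norm_adjM T : `|bop_mul (adj T) T| = `|T| ^+ 2.
Proof.
apply/eqP; rewrite eq_le; apply/andP; split.
  by rewrite (le_trans (op_normM _ _))// op_norm_adj.
rewrite -[leRHS]sqrtCK ler_pXn2r ?nnegrE ?sqrtC_ge0//.
apply: op_norm_le; split=> [|x]; first by rewrite sqrtC_ge0.
rewrite -(@ler_pXn2r _ 2) ?nnegrE ?mulr_ge0 ?sqrtC_ge0// exprMn sqrtCK.
rewrite -hdot_norm adjP.
apply: le_trans (real_ler_norm _) _.
  by rewrite -adjP hdot_norm ger0_real// exprn_ge0.
rewrite (le_trans (cauchy_schwarz _ _))// expr2 mulrA mulrC ler_wpM2r//.
exact: (bop_norm_bound (bop_mul (adj T) T)).
Qed.

Lemma bop_mulA : associative bop_mul.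
Proof. by move=> S T U; apply: bop_ext. Qed.

Lemma bop_mulDl : left_distributive bop_mul +%R.
Proof. by move=> S T U; apply: bop_ext. Qed.

Lemma bop_mulDr : right_distributive bop_mul +%R.
Proof. by move=> S T U; apply: bop_ext => x; rewrite /= linearD. Qed.

Lemma bop_mulZl (k : R[i]) S T : bop_mul (k *: S) T = k *: bop_mul S T.
Proof. exact: bop_ext. Qed.

Lemma bop_mulZr (k : R[i]) S T : bop_mul S (k *: T) = k *: bop_mul S T.
Proof. by apply: bop_ext => x; rewrite /= linearZ. Qed.

HB.instance Definition _ :=
  CompleteNormedModule_isCstarAlgebra.Build R bounded_op
  bop_mulA bop_mulDl bop_mulDr bop_mulZl bop_mulZr op_normM
  adjK adjD adjZ adjM op_norm_adjM.

End Adjointable.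
Arguments bounded_op {R} H.

(** * Unordered sums *)

Section RealSums.
Variables (R : realType) (X : choiceType).
Implicit Types (u v w : X -> R).

Definition rsummable u := (\esum_(x in [set: X]) `|u x|%:E < +oo)%E.

(** Only meaningful for summable [v] with nonnegative values. *)
Definition nsum v : R := fine (\esum_(x in [set: X]) (v x)%:E).

Definition rsum u : R :=
  nsum (fun x => Num.max (u x) 0) - nsum (fun x => Num.max (- u x) 0).

Lemma rsummable_le u v :
  (forall x, `|u x| <= v x) -> rsummable v -> rsummable u.
Proof.
move=> uv; apply: le_lt_trans; apply: le_esum => x _; rewrite lee_fin.
by rewrite (le_trans (uv x))// ler_norm.
Qed.

Lemma rsummableD u v : rsummable u -> rsummable v -> rsummable (u \+ v).
Proof. exact: (@summableD X R setT (EFin \o u) (EFin \o v)). Qed.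

Lemma rsummable_abs u : rsummable u -> rsummable (fun x => `|u x|).
Proof. by rewrite /rsummable => us; under eq_esum do rewrite normr_id. Qed.

Lemma nsum_le (M : R) v : (forall x, 0 <= v x) ->
  (forall A : {fset X}, \sum_(x <- A) v x <= M) -> rsummable v /\ nsum v <= M.
Proof.
move=> v0 vM.
have le : (\esum_(x in [set: X]) (v x)%:E <= M%:E)%E.
  apply: ge_ereal_sup => _ [A [finA _] <-].
  by rewrite fsbig_finite//= sumEFin lee_fin.
split.
  apply: le_lt_trans (ltry M); apply: le_trans le.
  by apply: le_esum => x _; rewrite ger0_norm.
rewrite -lee_fin fineK// ge0_fin_numE.
  exact: le_lt_trans (ltry M).
by apply: esum_ge0 => x _; rewrite lee_fin.
Qed.

Lemma nsumE v : (forall x, 0 <= v x) -> rsummable v ->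
  \esum_(x in [set: X]) (v x)%:E = (nsum v)%:E.
Proof.
move=> v0 vs; rewrite /nsum fineK// ge0_fin_numE.
  by move: vs; rewrite /rsummable; under eq_esum do rewrite ger0_norm//.
by apply: esum_ge0 => x _; rewrite lee_fin.
Qed.

Lemma fin_sum_le_nsum v (A : {fset X}) : (forall x, 0 <= v x) -> rsummable v ->
  \sum_(x <- A) v x <= nsum v.
Proof.
move=> v0 vs; rewrite -lee_fin -nsumE//; apply: esum_ge.
by exists [set` A]; rewrite ?fsbig_finite//= set_fsetK sumEFin.
Qed.

Lemma nsum_ge0 v : (forall x, 0 <= v x) -> 0 <= nsum v.
Proof. by move=> v0; apply/fine_ge0/esum_ge0 => x _; rewrite lee_fin. Qed.

Lemma nsumD v w : (forall x, 0 <= v x) -> (forall x, 0 <= w x) ->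
  rsummable v -> rsummable w -> nsum (v \+ w) = nsum v + nsum w.
Proof.
move=> v0 w0 vs ws; apply: EFin_inj; rewrite EFinD -!nsumE//=.
- by rewrite -esumD// => x _; rewrite lee_fin.
- by move=> x; rewrite addr_ge0.
- exact: rsummableD.
Qed.

Lemma nsumZ (a : R) v : 0 <= a -> (forall x, 0 <= v x) ->
  rsummable v ->
  rsummable (fun x => a * v x) /\ nsum (fun x => a * v x) = a * nsum v.
Proof.
move=> a0 v0 vs.
have le b w : 0 <= b -> (forall x, 0 <= w x) -> rsummable w ->
    rsummable (fun x => b * w x) /\ nsum (fun x => b * w x) <= b * nsum w.
  move=> b0 w0 ws; apply: nsum_le => [x|A]; first by rewrite mulr_ge0.
  by rewrite -big_distrr/= ler_wpM2l// fin_sum_le_nsum.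
have [s le1] := le a v a0 v0 vs; split=> //; apply/eqP; rewrite eq_le le1/=.
have [-> |an0] := eqVneq a 0.
  by rewrite mul0r nsum_ge0// => x; rewrite mul0r.
(* The inequality just proved, for the factor [a^-1], gives the converse. *)
rewrite -ler_pdivlMl ?lt0r ?an0//.
have [||_ le2] := le a^-1 (fun x => a * v x) _ _ s.
- by rewrite invr_ge0.
- by move=> x; rewrite mulr_ge0.
by apply: le_trans le2; under eq_fun do rewrite mulKf//.
Qed.

(** Any way of writing a function as a difference of nonnegative summable ones
    computes its sum: if [p] and [n] are its positive and negative parts then
    [p + w = n + v], and sums of nonnegative functions are additive. Linearity
    of [rsum] reduces to this. *)
Lemma rsum_sub v w : (forall x, 0 <= v x) -> (forall x, 0 <= w x) ->
  rsummable v -> rsummable w -> rsum (fun x => v x - w x) = nsum v - nsum w.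
Proof.
move=> v0 w0 vs ws; rewrite /rsum.
set p := (fun x => Num.max (v x - w x) 0).
set n := (fun x => Num.max (- (v x - w x)) 0).
have p0 x : 0 <= p x by rewrite le_max lexx orbT.
have n0 x : 0 <= n x by rewrite le_max lexx orbT.
have ps : rsummable p.
  apply: rsummable_le vs => x; rewrite ger0_norm// ge_max v0 andbT.
  by rewrite gerBl.
have ns : rsummable n.
  apply: rsummable_le ws => x; rewrite ger0_norm// ge_max w0 andbT.
  by rewrite opprB gerBl.
suff : nsum (p \+ w) = nsum (n \+ v).
  by rewrite !nsumD// => h; lra.
congr nsum; apply/funext => x /=; rewrite /p /n.
by have [] := leP (v x - w x) 0; have [] := leP (- (v x - w x)) 0; lra.
Qed.

Lemma pos_neg_part u : exists v w, [/\ forall x, 0 <= v x, forall x, 0 <= w x,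
  u = (fun x => v x - w x) & rsummable u -> rsummable v /\ rsummable w].
Proof.
exists (fun x => Num.max (u x) 0), (fun x => Num.max (- u x) 0); split.
- by move=> x; rewrite le_max lexx orbT.
- by move=> x; rewrite le_max lexx orbT.
- apply/funext => x.
  by have [] := leP (u x) 0; have [] := leP (- u x) 0; lra.
- move=> us; split; apply: rsummable_le (rsummable_abs us) => x;
    rewrite ger0_norm ?le_max ?lexx ?orbT// ge_max normr_ge0 andbT ?ler_norm//.
  by rewrite -normrN ler_norm.
Qed.

Lemma rsumD u u' :
  rsummable u -> rsummable u' -> rsum (u \+ u') = rsum u + rsum u'.
Proof.
have [v [w [v0 w0 -> h]]] := pos_neg_part u.
have [v' [w' [v'0 w'0 -> h']]] := pos_neg_part u'.
move=> /h[vs ws] /h'[v's w's]; rewrite !rsum_sub//.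
have -> : (fun x => v x - w x) \+ (fun x => v' x - w' x) =
   (fun x => (v \+ v') x - (w \+ w') x) by apply/funext => x /=; ring.
rewrite rsum_sub; try exact: rsummableD.
- by rewrite !nsumD//; ring.
- by move=> x; rewrite addr_ge0.
- by move=> x; rewrite addr_ge0.
Qed.

Lemma rsumN u : rsum (fun x => - u x) = - rsum u.
Proof.
by rewrite /rsum opprB; under [in X in _ - X]eq_fun do rewrite opprK.
Qed.

Lemma rsummableZ (a : R) u : rsummable u -> rsummable (fun x => a * u x).
Proof.
move=> us; apply: (@rsummable_le _ (fun x => `|a| * `|u x|)).
  by move=> x; rewrite normrM.
have abs0 x : 0 <= `|u x| := normr_ge0 _.
have [] := @nsumZ `|a| (fun x => `|u x|) (normr_ge0 _) abs0 => //.
exact: rsummable_abs.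
Qed.

Lemma rsumZ (a : R) u : rsummable u -> rsum (fun x => a * u x) = a * rsum u.
Proof.
wlog a0 : a / 0 <= a => [hw us|].
  have [a0|/ltW a0] := leP 0 a; first exact: hw.
  have -> : (fun x => a * u x) = (fun x => - (- a * u x)).
    by apply/funext => x; rewrite mulNr opprK.
  by rewrite rsumN hw ?oppr_ge0// mulNr opprK.
have [v [w [v0 w0 -> h]]] := pos_neg_part u => /h[vs ws].
have [avs av] := nsumZ a0 v0 vs; have [aws aw] := nsumZ a0 w0 ws.
under eq_fun do rewrite mulrBr.
by rewrite !rsum_sub// ?av ?aw ?mulrBr// => x; rewrite mulr_ge0.
Qed.

Lemma rsum_nsum v : (forall x, 0 <= v x) -> rsummable v -> rsum v = nsum v.
Proof.
move=> v0 vs; have := @rsum_sub v (fun=> 0) v0 (fun=> lexx 0) vs.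
have -> : (fun x => v x - 0) = v by apply/funext => x; rewrite subr0.
rewrite [nsum (fun=> 0)]/nsum esum1// subr0; apply.
by rewrite /rsummable esum1// => x _; rewrite normr0.
Qed.

Lemma nsum_mono u v : (forall x, 0 <= u x) -> (forall x, u x <= v x) ->
  rsummable v -> nsum u <= nsum v.
Proof.
move=> u0 uv vs; have v0 x : 0 <= v x := le_trans (u0 x) (uv x).
have [|_] := @nsum_le (nsum v) u u0; last exact.
by move=> A; apply: le_trans (fin_sum_le_nsum A v0 vs); exact: ler_sum.
Qed.

Lemma rsummable_reindex (P Q : set X) (e : X -> X) u : set_bij P Q e ->
  rsummable u -> rsummable (fun x => if x \in P then u (e x) else 0).
Proof.
move=> PQ; apply: le_lt_trans.
under eq_esum do rewrite (fun_if Num.norm) normr0 (fun_if EFin).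
rewrite -esum_mkcond -(reindex_esum P Q e (fun x => `|u x|%:E))//.
rewrite esum_mkcond; apply: le_esum => x _.
by case: ifP => // _; rewrite lee_fin.
Qed.

Lemma nsum_reindex (P Q : set X) (e : X -> X) v : set_bij P Q e ->
  nsum (fun x => if x \in P then v (e x) else 0) =
  nsum (fun x => if x \in Q then v x else 0).
Proof.
move=> PQ; rewrite /nsum; under eq_esum do rewrite (fun_if EFin).
rewrite -esum_mkcond; under [in RHS]eq_esum do rewrite (fun_if EFin).
by rewrite -esum_mkcond (reindex_esum P Q e).
Qed.

Lemma rsum_reindex (P Q : set X) (e : X -> X) u : set_bij P Q e ->
  rsum (fun x => if x \in P then u (e x) else 0) =
  rsum (fun x => if x \in Q then u x else 0).
Proof.
move=> PQ; rewrite /rsum.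
have E (b : bool) (r : R) :
   Num.max (if b then r else 0) 0 = if b then Num.max r 0 else 0.
  by case: b; rewrite ?maxxx.
have E' (b : bool) (r : R) :
   Num.max (- (if b then r else 0)) 0 = if b then Num.max (- r) 0 else 0.
  by case: b; rewrite ?oppr0 ?maxxx.
under [in X in X - _]eq_fun do rewrite E.
under [in X in _ - X]eq_fun do rewrite E'.
under [in X in _ = X - _]eq_fun do rewrite E.
under [in X in _ = _ - X]eq_fun do rewrite E'.
rewrite (nsum_reindex (fun x => Num.max (u x) 0) PQ).
by rewrite (nsum_reindex (fun x => Num.max (- u x) 0) PQ).
Qed.

End RealSums.

(** * Square-summable functions *)

Section ComplexSums.
Variables (R : realType) (X : choiceType).
Implicit Types (u v : X -> R[i]).
Local Notation Re := (@complex.Re R).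
Local Notation Im := (@complex.Im R).

Definition csummable u := rsummable (Re \o u) /\ rsummable (Im \o u).

Definition csum u : R[i] := rsum (Re \o u) +i* rsum (Im \o u).

Lemma csumD u v : csummable u -> csummable v -> csum (u \+ v) = csum u + csum v.
Proof.
move=> [us us'] [vs vs']; rewrite /csum.
have -> : Re \o (u \+ v) = (Re \o u) \+ (Re \o v).
  by apply/funext => x /=; case: (u x) (v x) => ? ? [].
have -> : Im \o (u \+ v) = (Im \o u) \+ (Im \o v).
  by apply/funext => x /=; case: (u x) (v x) => ? ? [].
by rewrite !rsumD.
Qed.

Lemma csumZ (k : R[i]) u : csummable u -> csum (fun x => k * u x) = k * csum u.
Proof.
move=> [us us']; rewrite /csum; case: k => a b.
have -> : Re \o (fun x => (a +i* b) * u x) =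
    (fun x => a * (Re \o u) x) \+ (fun x => - b * (Im \o u) x).
  by apply/funext => x /=; case: (u x) => ? ?; simpc; rewrite /=; ring.
have -> : Im \o (fun x => (a +i* b) * u x) =
    (fun x => b * (Re \o u) x) \+ (fun x => a * (Im \o u) x).
  by apply/funext => x /=; case: (u x) => ? ?; simpc; rewrite /=; ring.
rewrite !rsumD ?rsumZ//; try exact: rsummableZ.
by simpc; congr (_ +i* _); rewrite addrC.
Qed.

Lemma csum_conj u : csum (fun x => (u x)^*) = (csum u)^*.
Proof.
rewrite /csum -[RHS]/(rsum (Re \o u) +i* (- rsum (Im \o u))) -rsumN.
congr Complex; congr rsum.
  by apply/funext => x /=; case: (u x).
by apply/funext => x /=; case: (u x).
Qed.

Lemma csum_reindex (P Q : set X) (e : X -> X) u : set_bij P Q e ->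
  csum (fun x => if x \in P then u (e x) else 0) =
  csum (fun x => if x \in Q then u x else 0).
Proof.
move=> PQ; rewrite /csum.
have E (f : R[i] -> R) (b : bool) z : f 0 = 0 ->
  f (if b then z else 0) = if b then f z else 0 by case: b.
congr (_ +i* _).
  have -> : Re \o (fun x => if x \in P then u (e x) else 0) =
      (fun x => if x \in P then (Re \o u) (e x) else 0).
    by apply/funext => x /=; rewrite E.
  by rewrite (rsum_reindex _ PQ); congr rsum; apply/funext => x /=; rewrite E.
have -> : Im \o (fun x => if x \in P then u (e x) else 0) =
    (fun x => if x \in P then (Im \o u) (e x) else 0).
  by apply/funext => x /=; rewrite E.
by rewrite (rsum_reindex _ PQ); congr rsum; apply/funext => x /=; rewrite E.
Qed.

(** The squared modulus, as an element of [R]. *)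
Definition sqn (z : R[i]) : R := Re z ^+ 2 + Im z ^+ 2.

Lemma sqn_ge0 z : 0 <= sqn z.
Proof. by rewrite addr_ge0 ?sqr_ge0. Qed.

Lemma sqn_eq0 z : sqn z = 0 -> z = 0.
Proof.
case: z => a b /eqP; rewrite paddr_eq0 ?sqr_ge0// !sqrf_eq0.
by move=> /andP[/eqP/= -> /eqP/= ->].
Qed.

Lemma sqnE z : z * z^* = (sqn z)%:C.
Proof.
by case: z => a b; rewrite /sqn; simpc; congr (_ +i* _); rewrite /=; ring.
Qed.

Lemma sqnM k z : sqn (k * z) = sqn k * sqn z.
Proof. by case: k z => a b [c d]; rewrite /sqn; simpc => /=; ring. Qed.

Lemma sqnD_le z w : sqn (z + w) <= 2 * sqn z + 2 * sqn w.
Proof.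
case: z w => a b [c d]; rewrite /sqn -subr_ge0 /=.
suff -> : 2 * (a ^+ 2 + b ^+ 2) + 2 * (c ^+ 2 + d ^+ 2) -
  ((a + c) ^+ 2 + (b + d) ^+ 2) = (a - c) ^+ 2 + (b - d) ^+ 2.
  by rewrite addr_ge0// sqr_ge0.
by ring.
Qed.

Lemma Re_mulC_le z w : `|Re (z * w^*)| <= sqn z + sqn w.
Proof.
case: z w => a b [c d]; rewrite /sqn; simpc => /=.
have := sqr_ge0 (a - c); have := sqr_ge0 (b - d).
have := sqr_ge0 (a + c); have := sqr_ge0 (b + d).
by rewrite ler_norml => *; apply/andP; split; nra.
Qed.

Lemma Im_mulC_le z w : `|Im (z * w^*)| <= sqn z + sqn w.
Proof.
case: z w => a b [c d]; rewrite /sqn; simpc => /=.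
have := sqr_ge0 (a - d); have := sqr_ge0 (b - c).
have := sqr_ge0 (a + d); have := sqr_ge0 (b + c).
by rewrite ler_norml => *; apply/andP; split; nra.
Qed.

Definition square_summable : {pred X -> R[i]} :=
  mem [set u : X -> R[i] | rsummable (sqn \o u)].

Lemma square_summable_submod : submod_closed square_summable.
Proof.
split=> [|k u v]; rewrite !inE/=.
  rewrite /rsummable esum1// => x _.
  by rewrite /= /sqn /= expr0n/= addr0 normr0.
move=> us vs; apply: (@rsummable_le _ _ _
   ((fun x => 2 * sqn k * sqn (u x)) \+ (fun x => 2 * sqn (v x)))).
  move=> x /=; rewrite ger0_norm ?sqn_ge0//.
  by rewrite -mulrA -sqnM; exact: sqnD_le.
by apply: rsummableD; exact: rsummableZ.
Qed.

HB.instance Definition _ :=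
  GRing.isSubmodClosed.Build _ _ square_summable square_summable_submod.

Record ell2 := Ell2 { ell2_fun :> X -> R[i];
  ell2_square_summable : ell2_fun \in square_summable }.

HB.instance Definition _ := [isSub for ell2_fun].
HB.instance Definition _ := [Choice of ell2 by <:].
HB.instance Definition _ := [SubChoice_isSubLmodule of ell2 by <:].

Implicit Types f g : ell2.

Lemma ell2_rsummable f : rsummable (sqn \o f).
Proof. by have := ell2_square_summable f; rewrite inE. Qed.

Definition ell2_dot f g : R[i] := csum (fun x => f x * (g x)^*).

Lemma ell2_dot_csummable f g : csummable (fun x => f x * (g x)^*).
Proof.
have fg := rsummableD (ell2_rsummable f) (ell2_rsummable g).
by split; apply: rsummable_le fg => x /=;
  [exact: Re_mulC_le|exact: Im_mulC_le].
Qed.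

Lemma ell2_dotDl f f' g : ell2_dot (f + f') g = ell2_dot f g + ell2_dot f' g.
Proof.
rewrite /ell2_dot -csumD; try exact: ell2_dot_csummable.
by congr csum; apply/funext => x /=; rewrite mulrDl.
Qed.

Lemma ell2_dotZl (k : R[i]) f g : ell2_dot (k *: f) g = k * ell2_dot f g.
Proof.
rewrite /ell2_dot -csumZ; last exact: ell2_dot_csummable.
by congr csum; apply/funext => x /=; rewrite mulrA.
Qed.

Lemma ell2_dotC f g : ell2_dot f g = (ell2_dot g f)^*.
Proof.
rewrite /ell2_dot -csum_conj; congr csum; apply/funext => x.
by rewrite rmorphM/= conjcK mulrC.
Qed.

Lemma ell2_dotE f : ell2_dot f f = (nsum (sqn \o f))%:C.
Proof.
rewrite /ell2_dot /csum.
have -> : Re \o (fun x => f x * (f x)^*) = sqn \o f.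
  by apply/funext => x; rewrite /= sqnE.
have -> : Im \o (fun x => f x * (f x)^*) = fun=> 0.
  by apply/funext => x; rewrite /= sqnE.
have z0 : rsummable (fun _ : X => 0 : R).
  by rewrite /rsummable esum1// => x _; rewrite normr0.
rewrite rsum_nsum; [|by move=> x; exact: sqn_ge0|exact: ell2_rsummable].
rewrite rsum_nsum//; congr (_ +i* _).
by rewrite /nsum esum1.
Qed.

Lemma sqn_le_nsum f x : sqn (f x) <= nsum (sqn \o f).
Proof.
have := @fin_sum_le_nsum _ _ (sqn \o f) [fset x]%fset (fun=> sqn_ge0 _).
by rewrite big_seq_fset1; apply; exact: ell2_rsummable.
Qed.

Lemma ell2_dot_gt0 f : f != 0 -> 0 < ell2_dot f f.
Proof.
move=> f0; rewrite ell2_dotE ltcR lt0r nsum_ge0 ?andbT; last first.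
  by move=> x; exact: sqn_ge0.
apply: contra f0 => /eqP s0; apply/eqP/val_inj/funext => x /=.
apply: sqn_eq0; apply/eqP; rewrite eq_le sqn_ge0 andbT -s0.
exact: sqn_le_nsum.
Qed.

End ComplexSums.

(** * The Hilbert space of square-summable functions *)

Section Ell2Hilbert.
Variables (R : realType) (X : choiceType).
Local Notation Re := (@complex.Re R).
Local Notation Im := (@complex.Im R).
Local Notation ell2 := (ell2 R X).
Implicit Types f g : ell2.

Lemma ell2_dot_bilinear : bilinear_for
  (GRing.Scale.Law.clone _ _ ( *%R ) _)
  (GRing.Scale.Law.clone _ _ ((@Num.conj R[i]) \; *%R ) _) (@ell2_dot R X).
Proof.
split=> [g k f f'|f k g g'] /=; first by rewrite ell2_dotDl ell2_dotZl.
by rewrite ell2_dotC ell2_dotDl ell2_dotZl (ell2_dotC f g) (ell2_dotC f g')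
  rmorphD rmorphM.
Qed.

HB.instance Definition _ := bilinear_isBilinear.Build R[i] ell2 ell2 R[i]
  (GRing.Scale.Law.clone _ _ ( *%R ) _)
  (GRing.Scale.Law.clone _ _ ((@Num.conj R[i]) \; *%R ) _) (@ell2_dot R X)
  ell2_dot_bilinear.

Lemma ell2_dot_hermitian f g :
  ell2_dot f g = (-1) ^+ false * Num.conj (ell2_dot g f).
Proof. by rewrite mul1r ell2_dotC. Qed.

HB.instance Definition _ := isHermitianSesquilinear.Build R[i] ell2 false
  (@Num.conj R[i]) (@ell2_dot R X) ell2_dot_hermitian.

HB.instance Definition _ := isDotProduct.Build R[i] ell2 (@ell2_dot R X)
  (@ell2_dot_gt0 R X).

Definition ell2_form : {dot ell2 for (@Num.conj R[i])} := @ell2_dot R X.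

Definition ell2_norm f : R[i] := sqrtC (ell2_form f f).

Lemma ell2_norm_eq0 f : ell2_norm f = 0 -> f = 0.
Proof. by move/eqP; rewrite sqrt_dnorm_eq0 => /eqP. Qed.

HB.instance Definition _ := Lmodule_isNormed.Build R[i] ell2
  (sqrt_dnormD ell2_form) (sqrt_dnormZ ell2_form) ell2_norm_eq0.

Lemma ell2_normE f : `|f| ^+ 2 = (nsum (@sqn R \o f))%:C.
Proof. by rewrite [LHS]sqrtCK; exact: ell2_dotE. Qed.

Lemma Re_sqr (z : R[i]) : 0 <= z -> z ^+ 2 = (Re z ^+ 2)%:C.
Proof. by move=> /ger0_real/RRe_real {1}<-; rewrite -rmorphXn. Qed.

Lemma ell2_norm_le f (M : R[i]) : 0 <= M ->
  `|f| <= M <-> nsum (@sqn R \o f) <= Re M ^+ 2.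
Proof.
by move=> M0; rewrite -(@ler_pXn2r _ 2) ?nnegrE// ell2_normE Re_sqr// lecR.
Qed.

(** Values at a point converge along a Cauchy filter because real and
    imaginary parts do; a bound on the norm is a bound on all finite sums of
    squared moduli, and each of these passes to the pointwise limit. *)
Lemma ell2_complete (F : set_system ell2) : ProperFilter F -> cauchy F -> cvg F.
Proof.
move=> FF Fc; have /cauchyP Fe := Fc.
have cvg_coord (p : R[i] -> R) : {morph p : z w / z - w} ->
    (forall z, p z ^+ 2 <= sqn z) ->
    forall x, cvg ((fun f : ell2 => p (f x)) @ F).
  move=> pB ps x; apply: cauchy_cvg; apply/cauchyP => e e0.
  have e0' : 0 < e%:C by rewrite ltcR.
  have [f Ff] := Fe _ e0'; exists (p (f x)).
  suff: F [set g | ball (p (f x)) e (p (g x))] by [].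
  apply: filterS Ff => g; rewrite -!ball_normE /ball_ /= => fg.
  rewrite -pB -ltr_sqr ?nnegrE// ?ltW// -normrX ger0_norm ?sqr_ge0//.
  have : `|f - g| ^+ 2 < e%:C ^+ 2 by rewrite ltr_pXn2r// nnegrE// ltW.
  rewrite ell2_normE Re_sqr ?ltW// ltcR; apply: le_lt_trans.
  by apply: le_trans (sqn_le_nsum (f - g) x); exact: ps.
have cvgRe x : cvg ((fun f : ell2 => Re (f x)) @ F).
  apply: (cvg_coord Re) => [[a b] [c d]//|z].
  by rewrite /sqn lerDl sqr_ge0.
have cvgIm x : cvg ((fun f : ell2 => Im (f x)) @ F).
  apply: (cvg_coord Im) => [[a b] [c d]//|z].
  by rewrite /sqn lerDr sqr_ge0.
pose l x := lim ((fun f : ell2 => Re (f x)) @ F) +i*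
            lim ((fun f : ell2 => Im (f x)) @ F).
have ball_l (e : R[i]) f : 0 < e -> F (ball f e) ->
    rsummable (fun x => sqn (f x - l x)) /\
    nsum (fun x => sqn (f x - l x)) <= Re e ^+ 2.
  move=> e0 Ff; apply: nsum_le => [x|A]; first exact: sqn_ge0.
  apply: (@cvgr_to_le _ F _ _ (fun g : ell2 => \sum_(x <- A) sqn (f x - g x))).
    apply: cvg_big => [|x _]; first exact: add_continuous.
    rewrite /sqn.
    have hr : (fun g : ell2 => Re (f x - g x)) @ F --> Re (f x - l x).
      have -> : (fun g : ell2 => Re (f x - g x)) =
          (fun g : ell2 => Re (f x) - Re (g x)).
        by apply/funext => g; case: (f x) (g x) => a b [].
      have -> : Re (f x - l x) = Re (f x) - Re (l x).
        by case: (f x) (l x) => a b [].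
      by apply: cvgB; [exact: cvg_cst|exact: cvgRe].
    have hi : (fun g : ell2 => Im (f x - g x)) @ F --> Im (f x - l x).
      have -> : (fun g : ell2 => Im (f x - g x)) =
          (fun g : ell2 => Im (f x) - Im (g x)).
        by apply/funext => g; case: (f x) (g x) => a b [].
      have -> : Im (f x - l x) = Im (f x) - Im (l x).
        by case: (f x) (l x) => a b [].
      by apply: cvgB; [exact: cvg_cst|exact: cvgIm].
    by apply: cvgD; [exact: (cvgM hr hr)|exact: (cvgM hi hi)].
  apply: filterS Ff => g; rewrite -ball_normE /ball_/= => fg.
  have /ell2_norm_le : `|f - g| <= e by exact: ltW.
  move=> /(_ (ltW e0)); apply: le_trans.
  apply: (@fin_sum_le_nsum _ _ (@sqn R \o (f - g)) A (fun=> sqn_ge0 _)).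
  exact: ell2_rsummable.
have [f0 Ff0] := Fe _ ltr01.
have fl : f0 \- l \in @square_summable R X.
  by rewrite inE/=; have [] := ball_l _ _ ltr01 Ff0.
pose L := f0 - Ell2 fl.
have LE x : L x = l x by rewrite -[L x]/(f0 x - (f0 x - l x)) subKr.
apply: (@cvg_of_ball_limit _ _ _ L) => // e f e0 Ff.
apply/ell2_norm_le; first exact: ltW.
have [_] := ball_l _ _ e0 Ff; congr (nsum _ <= _).
by apply/funext => x; rewrite -LE.
Qed.

HB.instance Definition _ := Uniform_isComplete.Build ell2 ell2_complete.

Lemma ell2_dot_norm f : ell2_form f f = `|f| ^+ 2.
Proof. by rewrite [RHS]sqrtCK. Qed.

HB.instance Definition _ := CompleteNormedModule_isHilbert.Build R ell2
  ell2_dot_norm.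

End Ell2Hilbert.

(** * Operators induced by partial bijections *)

(** The inverse is part of the data, so that exchanging the two directions is
    an operation on partial bijections, which corresponds to the adjoint. *)
Record partial_bijection (X : Type) := PartialBijection {
  pb_dom : set X; pb_cod : set X; pb_fun : X -> X; pb_inv : X -> X;
  pb_funP : forall x, pb_dom x -> pb_cod (pb_fun x);
  pb_invP : forall x, pb_cod x -> pb_dom (pb_inv x);
  pb_funK : forall x, pb_dom x -> pb_inv (pb_fun x) = x;
  pb_invK : forall x, pb_cod x -> pb_fun (pb_inv x) = x }.

Definition pb_sym X (b : partial_bijection X) :=
  PartialBijection (pb_invP (p := b)) (pb_funP (p := b))
    (pb_invK (p := b)) (pb_funK (p := b)).

Definition pb_id X (P : set X) : partial_bijection X :=
  @PartialBijection X P P id id (fun _ => id) (fun _ => id)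
    (fun _ _ => erefl) (fun _ _ => erefl).

Section Pullback.
Variables (R : realType) (X : choiceType).
Implicit Types (b : partial_bijection X) (f g : ell2 R X).

Lemma pb_bij b : set_bij (pb_dom b) (pb_cod b) (pb_fun b).
Proof.
split=> [x xb|x y|x xb]; first exact: pb_funP; last first.
  by exists (pb_inv b x); [exact: pb_invP|exact: pb_invK].
by rewrite !inE => xb yb xy; rewrite -(pb_funK xb) xy pb_funK.
Qed.

(** On basis vectors this operator sends the one at [pb_fun b x] to the one at
    [x], and kills the basis vectors outside the codomain. *)
Definition pullback_fun b (f : X -> R[i]) : X -> R[i] :=
  fun x => if x \in pb_dom b then f (pb_fun b x) else 0.

Lemma sqn0 : sqn (0 : R[i]) = 0.
Proof. by rewrite /sqn /= expr0n addr0. Qed.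

Lemma pullback_sqn b f : @sqn R \o pullback_fun b f =
  (fun x => if x \in pb_dom b then (@sqn R \o f) (pb_fun b x) else 0).
Proof.
by apply/funext => x /=; rewrite /pullback_fun; case: ifP; rewrite ?sqn0.
Qed.

Lemma pullback_square_summable b f : pullback_fun b f \in @square_summable R X.
Proof.
rewrite inE/= pullback_sqn; apply: rsummable_reindex (pb_bij b) _.
exact: ell2_rsummable.
Qed.

Definition pullback_ell2 b f : ell2 R X := Ell2 (pullback_square_summable b f).

Lemma pullback_norm b f : `|pullback_ell2 b f| <= `|f|.
Proof.
apply/ell2_norm_le => //; rewrite -lecR -Re_sqr// ell2_normE lecR.
rewrite /= pullback_sqn (nsum_reindex _ (pb_bij b)).
apply: nsum_mono => [x|x|]; last exact: ell2_rsummable.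
  by case: ifP => // _; exact: sqn_ge0.
by case: ifP => // _; exact: sqn_ge0.
Qed.

(** Reindexing along [b] the sum that defines the inner product. *)
Lemma pullback_adjoint b :
  is_adjoint (pullback_ell2 b) (pullback_ell2 (pb_sym b)).
Proof.
move=> f g; rewrite -[LHS]/(ell2_dot _ _) -[RHS]/(ell2_dot _ _) /ell2_dot.
pose u y := f y * (g (pb_inv b y))^*.
transitivity (csum (fun x => if x \in pb_dom b then u (pb_fun b x) else 0)).
  congr csum; apply/funext => x; rewrite /= /pullback_fun /u.
  by case: ifPn => [/set_mem xb|_]; rewrite ?mul0r// pb_funK.
rewrite (csum_reindex u (pb_bij b)); congr csum; apply/funext => x.
by rewrite /= /pullback_fun /u /=; case: ifP; rewrite ?rmorph0 ?mulr0.
Qed.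

Lemma pullback_bounded_adjointable b :
  pullback_ell2 b \in bounded_adjointable (H := ell2 R X).
Proof.
rewrite inE/=; split.
  by exists (pullback_ell2 (pb_sym b)); exact: pullback_adjoint.
by exists 1; split=> // f; rewrite mul1r pullback_norm.
Qed.

Definition pullback b : bounded_op (ell2 R X) :=
  BoundedOp (pullback_bounded_adjointable b).

Lemma cstar_pullback b : cstar (pullback b) = pullback (pb_sym b).
Proof. exact/adj_unique/pullback_adjoint. Qed.

Lemma bop_cmulE (S T : bounded_op (ell2 R X)) f : cmul S T f = S (T f).
Proof. by []. Qed.

Lemma bop_ell2P (S T : bounded_op (ell2 R X)) :
  (forall f x, S f x = T f x) -> S = T.
Proof.
by move=> ST; apply: bop_ext => f; apply/val_inj/funext => x; exact: ST.
Qed.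

End Pullback.
Arguments pullback R {X} b.

(** * Relative ranges *)

Section RelativeRange.
Variable G : labelled_graph.
Implicit Types (A : set (vertex G)) (a : letter G) (alpha : seq (letter G)).

Lemma labels_ge1_letter a : labels_ge1 [:: a].
Proof. by have [e ea] := label_surj a; exists e, [::]; rewrite /= ea. Qed.

Lemma rel_range_letterP A a v :
  rel_range A [:: a] v <->
  exists e, [/\ label e = a, A (source e) & Defs.range e = v].
Proof.
split=> [[e [[|f l] [_ []// ea Ae ev]]]|[e [ea Ae ev]]]; first by exists e.
by exists e, [::]; split=> //=; rewrite ea.
Qed.

Lemma rel_range_mono A A' alpha :
  A `<=` A' -> rel_range A alpha `<=` rel_range A' alpha.
Proof.
case: alpha => [//|a alpha] AA' v [e [l [el la Ae lv]]].
by exists e, l; split=> //; exact: AA'.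
Qed.

Lemma rel_range_letterU A A' a :
  rel_range (A `|` A') [:: a] = rel_range A [:: a] `|` rel_range A' [:: a].
Proof.
apply/seteqP; split=> v; last first.
  by move=> [|]; apply: rel_range_mono => x; [left|right].
move=> /rel_range_letterP[e [ea [Ae|Ae] ev]]; [left|right];
  by apply/rel_range_letterP; exists e.
Qed.

Lemma rel_range_letter0 a : rel_range set0 [:: a] = set0 :> set (vertex G).
Proof. by rewrite -subset0 => v /rel_range_letterP[e []]. Qed.

Lemma rel_range_cons A a alpha :
  rel_range A (a :: alpha) = rel_range (rel_range A [:: a]) alpha.
Proof.
case: alpha => [//|b alpha]; apply/seteqP; split=> v.
  move=> [e [[|f l] [//= [ef fl] [ea fb la] Ae lv]]].
  exists f, l; split=> //=; first by rewrite fb la.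
  by rewrite -ef; apply/rel_range_letterP; exists e.
move=> [f [l [fl fb /rel_range_letterP[e [ea Ae ef]] lv]]].
by exists e, (f :: l); split=> //=; rewrite ea -fb.
Qed.

Lemma word_range_cons a alpha :
  word_range (a :: alpha) = rel_range (word_range (G := G) [:: a]) alpha.
Proof. exact: rel_range_cons. Qed.

Lemma word_range_behead a alpha :
  word_range (a :: alpha) `<=` word_range (G := G) alpha.
Proof. by rewrite word_range_cons; exact: rel_range_mono. Qed.

Lemma labels_star_behead a alpha :
  labels_star (G := G) (a :: alpha) -> labels_star alpha.
Proof.
case=> [//|[e [[|f l] [/= el [ea la]]]]]; first by left; rewrite /= -la.
by right; exists f, l; case: el.
Qed.

End RelativeRange.

(** * The boundary path space of a labelled space *)

Section BoundaryPaths.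
Variables (G : labelled_graph) (B : set (set (vertex G))).
Hypothesis hB : accommodating B.
Hypothesis hwlr : weakly_left_resolving B.
Hypothesis hcompl : closed_rel_compl B.
Implicit Types (A : set (vertex G)) (a : letter G) (alpha : seq (letter G)).
Implicit Types F : set (set (vertex G)).

Lemma B_range A a : B A -> B (rel_range A [:: a]).
Proof.
move=> BA; apply: (accommodating_range hB) => //.
by right; exact: labels_ge1_letter.
Qed.

Lemma B_letter a : B (word_range [:: a]).
Proof. exact/(accommodating_word hB)/labels_ge1_letter. Qed.

Lemma rel_range_letterI A A' a : B A -> B A' ->
  rel_range (A `&` A') [:: a] = rel_range A [:: a] `&` rel_range A' [:: a].
Proof. by move=> BA BA'; apply: hwlr => //; exact: labels_ge1_letter. Qed.

(** The points of the space dual to the family [B]. The empty family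
    qualifies: it arises as [pull_filter a F] when no [A] in [B] has its
    relative range in [F], which can happen when the whole vertex set is not
    in [B]. *)
Record prime_filter F : Prop := PrimeFilter {
  prime_filter_sub : F `<=` B;
  prime_filter0 : ~ F set0;
  prime_filterI : forall A A', B A -> B A' -> F (A `&` A') <-> F A /\ F A';
  prime_filterU : forall A A', B A -> B A' -> F (A `|` A') <-> F A \/ F A' }.

(** The map dual to [A |-> rel_range A [:: a]], which is a morphism for
    intersections because the space is weakly left-resolving. *)
Definition pull_filter a F : set (set (vertex G)) :=
  [set A | B A /\ F (rel_range A [:: a])].

Lemma pull_filterE a F A : pull_filter a F A = (B A /\ F (rel_range A [:: a])).
Proof. by []. Qed.

(** The sets for which the last defining relation is imposed. *)
Definition regular A : Prop :=
  [/\ B A, out_labels A !=set0, finite_set (out_labels A) &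
    ~ exists A', [/\ B A', A' !=set0 & A' `<=` A `&` sinks (G := G)]].

Lemma prime_filterS F A A' :
  prime_filter F -> B A' -> A `<=` A' -> F A -> F A'.
Proof.
move=> Fp BA' /setIidl AA' FA; have BA := prime_filter_sub Fp FA.
by have := prime_filterI Fp BA BA'; rewrite AA' => -[] /(_ FA)[].
Qed.

Lemma prime_filter_pull a F : prime_filter F -> prime_filter (pull_filter a F).
Proof.
move=> Fp; split=> [A []//||A A' BA BA'|A A' BA BA'].
- by move=> [_]; rewrite rel_range_letter0; exact: prime_filter0.
- have := prime_filterI Fp (B_range a BA) (B_range a BA').
  have := accommodatingI hB BA BA'.
  by rewrite !pull_filterE rel_range_letterI//; tauto.
- have := prime_filterU Fp (B_range a BA) (B_range a BA').
  have := accommodatingU hB BA BA'.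
  by rewrite !pull_filterE rel_range_letterU; tauto.
Qed.

Lemma vertex_prime_filter (v : vertex G) :
  prime_filter [set A | B A /\ A v].
Proof.
split=> [A []//|[]//|A A' BA BA'|A A' BA BA'] /=.
  by have := accommodatingI hB BA BA'; rewrite /setI/=; tauto.
by have := accommodatingU hB BA BA'; rewrite /setU/=; tauto.
Qed.

Lemma ultra_prime_filter (U : set (set (vertex G))) :
  UltraFilter U -> prime_filter (B `&` U).
Proof.
move=> Uu; split=> [A []//|[_]|A A' BA BA'|A A' BA BA'].
- exact: filter_not_empty.
- split=> [[_ UA]|[[_ UA] [_ UA']]].
    by split; split=> //; apply: filterS UA => v [].
  by split; [exact: accommodatingI|exact: filterI].
- split=> [[_ UA]|[[_ UA]|[_ UA]]]; first last.
  + by split; [exact: accommodatingU|apply: filterS UA => v; right].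
  + by split; [exact: accommodatingU|apply: filterS UA => v; left].
  have [UA1|UA1] := in_ultra_setVsetC A Uu; first by left.
  by right; split=> //; apply: filterS (filterI UA UA1) => v [[]].
Qed.

(** Finitely many members of the filter that are killed by one letter each can
    be replaced by their intersection. *)
Lemma prime_filter_finite_avoid F A (s : seq {classic letter G}) :
  prime_filter F -> F A ->
  (forall a : {classic letter G}, a \in s ->
    exists2 A', F A' & rel_range A' [:: (a : letter G)] = set0) ->
  exists A', [/\ F A', A' `<=` A &
    forall a : {classic letter G}, a \in s ->
      rel_range A' [:: (a : letter G)] = set0].
Proof.
move=> Fp FA; elim: s => [_|a s IH h]; first by exists A; split.
have [A1 [FA1 A1A A1s]] := IH (fun b bs => h b (mem_behead (s := a :: s) bs)).
have [A2 FA2 A2a] := h a (mem_head _ _).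
have [BA1 BA2] := (prime_filter_sub Fp FA1, prime_filter_sub Fp FA2).
exists (A1 `&` A2); split=> [|v [/A1A]//|b].
  by apply/prime_filterI.
rewrite in_cons => /predU1P[->|/A1s b0]; rewrite -subset0.
  by rewrite -[X in _ `<=` X]A2a; apply: rel_range_mono; exact: subIsetr.
by rewrite -[X in _ `<=` X]b0; apply: rel_range_mono; exact: subIsetl.
Qed.

(** Otherwise each of the finitely many letters leaving [A] kills some member
    of the filter, so one member of the filter inside [A] is killed by all of
    them. It is nonempty and emits no edge, which regularity of [A] excludes. *)
Lemma regular_letter F A : prime_filter F -> F A -> regular A ->
  exists a, forall A', F A' -> rel_range A' [:: a] !=set0.
Proof.
move=> Fp FA [BA _ finA noA]; apply: contrapT => /forallNP h.
have [s sA] := (finite_seqP (out_labels A : set {classic letter G})).1 finA.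
have [a as_|A' [FA' A'A A's]] := @prime_filter_finite_avoid F A s Fp FA.
  have /existsNP[A' /not_implyP[FA' A'a]] := h a.
  by exists A' => //; apply/eqP; apply: contrapT => /negP/set0P.
have BA' := prime_filter_sub Fp FA'.
apply: noA; exists A'; split=> //.
  by apply/set0P/eqP => A'0; apply: (prime_filter0 Fp); rewrite -A'0.
move=> v A'v; split; first exact: A'A.
move=> e ev; have : label e \in s.
  have : (out_labels A : set {classic letter G}) (label e).
    by exists e; rewrite ev; split=> //; exact: A'A.
  by rewrite sA.
move=> /A's/seteqP[/(_ (Defs.range e)) + _]; apply.
by apply/rel_range_letterP; exists e; rewrite ev.
Qed.

(** With the letter [a] of [regular_letter], the relative ranges of the
    members of [F] generate a proper filter on vertices; the trace on [B] of
    an ultrafilter refining it is a prime filter [F'] with [F] included in its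
    pull-back. Equality holds because closure under relative complements makes
    [F] maximal: if [A'] were in the pull-back but not in [F], then [A `\` A']
    would be in [F], while [A'] and [A `\` A'] have disjoint relative ranges. *)
Lemma regular_step F A : prime_filter F -> F A -> regular A ->
  exists a F',
    [/\ prime_filter F', F' (word_range [:: a]) & F = pull_filter a F'].
Proof.
move=> Fp FA rA; have [a Fa] := regular_letter Fp FA rA.
pose Phi := filter_from F (fun A' => rel_range A' [:: a]).
have PhiF : ProperFilter Phi.
  apply: filter_from_proper; last exact: Fa.
  apply: filter_from_filter; first by exists A.
  move=> A1 A2 FA1 FA2.
  have [BA1 BA2] := (prime_filter_sub Fp FA1, prime_filter_sub Fp FA2).
  exists (A1 `&` A2); first exact/(prime_filterI Fp BA1 BA2).
  by rewrite rel_range_letterI.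
have [U [Uu PhiU]] := ultraFilterLemma PhiF.
have UF A' : F A' -> U (rel_range A' [:: a]).
  by move=> FA'; apply: PhiU; exists A'.
exists a, (B `&` U); split; first exact: ultra_prime_filter.
  split; first exact: B_letter.
  by apply: filterS (UF _ FA); exact: rel_range_mono.
apply/seteqP; split=> [A' FA'|A' [BA' [_ UA']]].
  have BA' := prime_filter_sub Fp FA'.
  by split=> //; split; [exact: B_range|exact: UF].
apply: contrapT => nFA'.
have BA := prime_filter_sub Fp FA.
have BAA' : B (A `\` A') by exact: hcompl.
have BAI : B (A `&` A') by exact: (accommodatingI hB).
have : F ((A `&` A') `|` (A `\` A')) by rewrite setUIDK.
move=> /(prime_filterU Fp BAI BAA')[/(prime_filterI Fp BA BA')[]//|].
move=> /UF UD; apply: (@filter_not_empty _ U).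
rewrite -(rel_range_letter0 a) -(setDIK A' A) rel_range_letterI//.
by apply: filterI.
Qed.

(** One step of a boundary path. Stopping, which [None] stands for, is
    forbidden at a filter with a regular member. *)
Definition link F (o : option (letter G)) F' : Prop :=
  if o is Some a then F' (word_range [:: a]) /\ F = pull_filter a F'
  else forall A, F A -> ~ regular A.

(** The hypothesis on [F] comes after the existential, so that the axiom of
    choice yields a successor function on all families. *)
Lemma link_exists F : exists oF' : option (letter G) * set (set (vertex G)),
  prime_filter F -> prime_filter oF'.2 /\ link F oF'.1 oF'.2.
Proof.
have [[A [FA rA]]|nr] := pselect (exists A, F A /\ regular A); last first.
  by exists (None, F) => Fp; split=> //= A FA rA; apply: nr; exists A.
have [Fp|//] := pselect (prime_filter F); last by exists (None, F).
have [a [F' [F'p F'a FF']]] := regular_step Fp FA rA.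
by exists (Some a, F').
Qed.

(** The filter and the outgoing letter at each stage. After a stage without
    letter the sequence carries on with no link to what precedes, so that
    finite and infinite paths are treated alike. *)
Definition boundary_seq := nat -> set (set (vertex G)) * option (letter G).
Implicit Types x y : boundary_seq.

Definition boundary_path : set boundary_seq :=
  [set x | forall i, prime_filter (x i).1 /\ link (x i).1 (x i).2 (x i.+1).1].

Definition cylinder A : set boundary_seq :=
  boundary_path `&` [set x | (x 0).1 A].

Definition starts_with a : set boundary_seq :=
  boundary_path `&` [set x | (x 0).2 = Some a].

Definition tail x : boundary_seq := fun n => x n.+1.

Definition prepend a x : boundary_seq :=
  fun n => if n is m.+1 then x m else (pull_filter a (x 0).1, Some a).

Lemma tail_boundary_path x : boundary_path x -> boundary_path (tail x).
Proof. by move=> xb i; exact: xb. Qed.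

Lemma prependK a : cancel (prepend a) tail.
Proof. by move=> x; apply/funext. Qed.

Lemma tailK a x : starts_with a x -> prepend a (tail x) = x.
Proof.
move=> [xb xa]; apply/funext => -[|//] /=; have [_] := xb 0; rewrite xa.
by move=> [_ <-]; rewrite -[X in (_, X) = _]xa; case: (x 0).
Qed.

Lemma tail_starts_with a x :
  starts_with a x -> cylinder (word_range [:: a]) (tail x).
Proof.
move=> [xb xa]; split; first exact: tail_boundary_path.
by have [_] := xb 0; rewrite xa => -[].
Qed.

Lemma prepend_cylinder a x :
  cylinder (word_range [:: a]) x -> starts_with a (prepend a x).
Proof.
move=> [xb xa]; split=> // -[|i]; last exact: xb.
by split; [exact/prime_filter_pull/(xb 0).1|].
Qed.

(** This is the commutation relation between projections and partial
    isometries, at the level of paths. *)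
Lemma cylinder_tail A a x : B A -> starts_with a x ->
  cylinder A x <-> cylinder (rel_range A [:: a]) (tail x).
Proof.
move=> BA [xb xa]; have [_] := xb 0; rewrite xa => -[_ xE].
have xb' := tail_boundary_path xb.
by rewrite /cylinder/= xE pull_filterE; tauto.
Qed.

Lemma cylinder0 : cylinder set0 = set0.
Proof. by rewrite -subset0 => x [xb]; exact: prime_filter0 (xb 0).1. Qed.

Lemma cylinderI A A' : B A -> B A' ->
  cylinder (A `&` A') = cylinder A `&` cylinder A'.
Proof.
move=> BA BA'; apply/seteqP; split=> x [].
  by move=> xb /(prime_filterI (xb 0).1 BA BA')[].
by move=> [xb xA] [_ xA']; split=> //; apply/(prime_filterI (xb 0).1).
Qed.

Lemma cylinderU A A' : B A -> B A' ->
  cylinder (A `|` A') = cylinder A `|` cylinder A'.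
Proof.
move=> BA BA'; apply/seteqP; split=> x.
  by move=> [xb /(prime_filterU (xb 0).1 BA BA')[]]; [left|right].
by move=> [] [xb xA]; split=> //; apply/(prime_filterU (xb 0).1) => //;
  [left|right].
Qed.

Lemma cylinderS A A' : B A' -> A `<=` A' -> cylinder A `<=` cylinder A'.
Proof.
move=> BA' AA' x [xb xA]; split=> //.
by apply: prime_filterS xA; first exact: (xb 0).1.
Qed.

(** This is the last defining relation at the level of paths: the first filter
    has a regular member, so the path cannot stop there. *)
Lemma cylinder_regular A x : regular A -> cylinder A x ->
  exists2 a, out_labels A a & starts_with a x.
Proof.
move=> rA [xb xA]; have [xp] := xb 0.
case E : (x 0).2 => [a|] /=; last by move=> /(_ _ xA).
move=> [_ x0]; exists a => //; move: xA; rewrite /= x0 pull_filterE => -[_ x1A].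
have [v /rel_range_letterP[e [ea Ae _]]] : rel_range A [:: a] !=set0.
  by apply/set0P/eqP => r0; apply: (prime_filter0 (xb 1).1); rewrite -r0.
by exists e.
Qed.

(** Start from the principal filter of a vertex of [A] and iterate a choice of
    successors. *)
Lemma cylinder_nonempty A : B A -> A !=set0 -> cylinder A !=set0.
Proof.
move=> BA [v Av]; have [nxt nxtP] := choice link_exists.
pose F n := iter n (fun F => (nxt F).2) [set A | B A /\ A v].
have Fp n : prime_filter (F n).
  by elim: n => [|n /nxtP[]//]; exact: vertex_prime_filter.
exists (fun n => (F n, (nxt (F n)).1)); split=> // i; split; first exact: Fp.
by have [] := nxtP _ (Fp i).
Qed.

Fixpoint prepend_word alpha x : boundary_seq :=
  if alpha is a :: alpha' then prepend a (prepend_word alpha' x) else x.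

Lemma prepend_cylinder_range A a x : B A ->
  cylinder (rel_range A [:: a]) x -> cylinder A (prepend a x).
Proof.
move=> BA xA; apply/(cylinder_tail (a := a) BA).
  apply: prepend_cylinder; apply: cylinderS xA; first exact: B_letter.
  exact: rel_range_mono.
by rewrite prependK.
Qed.

Lemma prepend_word_cylinder A alpha x : B A ->
  cylinder (rel_range A alpha) x -> cylinder A (prepend_word alpha x).
Proof.
elim: alpha A => [//|a alpha IH] A BA; rewrite rel_range_cons => xA /=.
by apply: prepend_cylinder_range => //; apply: IH => //; exact: B_range.
Qed.

Lemma prepend_word_in_range A a alpha x : labels_star (a :: alpha) ->
  A `<=` word_range (a :: alpha) -> cylinder A x ->
  cylinder (word_range [:: a]) (prepend_word alpha x).
Proof.
move=> la AW xA; apply: prepend_word_cylinder; first exact: B_letter.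
rewrite -word_range_cons; apply: cylinderS xA => //.
by apply: (accommodating_word hB); case: la.
Qed.

End BoundaryPaths.

(** * The representation on boundary paths *)

Section BoundaryRepresentation.
Variables (R : realType) (G : labelled_graph) (B : set (set (vertex G))).
Hypothesis hB : accommodating B.
Hypothesis hwlr : weakly_left_resolving B.
Hypothesis hcompl : closed_rel_compl B.
Implicit Types (A : set (vertex G)) (a : letter G).
Implicit Types (alpha beta : seq (letter G)).

Local Notation X := {classic boundary_seq G}.
Local Notation H := (ell2 R X).
Implicit Types (f : H) (x : X).

Definition letter_pb a : partial_bijection X :=
  @PartialBijection X (starts_with B a) (cylinder B (word_range [:: a]))
    (@tail G) (prepend B a) (@tail_starts_with G B a)
    (@prepend_cylinder G B hB hwlr a) (@tailK G B a)
    (fun x _ => @prependK G B a x).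

Definition cylinder_proj A : bounded_op H :=
  pullback R (pb_id (cylinder B A : set X)).

Definition letter_isom a : bounded_op H := pullback R (letter_pb a).

Local Notation q := cylinder_proj.
Local Notation t := letter_isom.

Lemma cylinder_projE A f x : q A f x = if x \in cylinder B A then f x else 0.
Proof. by []. Qed.

Lemma letter_isomE a f x :
  t a f x = if x \in starts_with B a then f (tail x) else 0.
Proof. by []. Qed.

Lemma letter_isom_starE a f x : cstar (t a) f x =
  if x \in cylinder B (word_range [:: a]) then f (prepend B a x) else 0.
Proof. by rewrite cstar_pullback. Qed.

Lemma starts_with_inj a b x :
  x \in starts_with B a -> x \in starts_with B b -> a = b.
Proof. by move=> /set_mem[_ /= xa] /set_mem[_ /=]; rewrite xa => -[]. Qed.

Lemma mem_cylinder_tail A a x : B A -> starts_with B a x ->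
  (tail x \in cylinder B (rel_range A [:: a])) = (x \in cylinder B A).
Proof.
move=> BA xa.
by apply/idP/idP => /set_mem h; apply/mem_set/(cylinder_tail BA xa).
Qed.

Lemma letter_range_projE A a f x : B A ->
  cmul (cmul (t a) (q (rel_range A [:: a]))) (cstar (t a)) f x =
  if (x \in cylinder B A) && (x \in starts_with B a) then f x else 0.
Proof.
move=> BA; rewrite !bop_cmulE letter_isomE andbC.
case: ifPn => // xa; rewrite andTb.
have xa' := set_mem xa.
rewrite cylinder_projE letter_isom_starE (mem_set (tail_starts_with xa')).
by rewrite (tailK xa') (mem_cylinder_tail BA xa').
Qed.

Lemma bop_ell2_sumE (I : choiceType) (s : seq I) (T : I -> bounded_op H) f x :
  (\sum_(i <- s) T i) f x = \sum_(i <- s) (T i f x).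
Proof. by elim: s => [|i s IH]; rewrite ?big_nil// !big_cons -IH. Qed.

Lemma boundary_relations : satisfies_relations B q t.
Proof.
split.
- move=> A _; split; first by rewrite cstar_pullback.
  apply: bop_ell2P => f x; rewrite bop_cmulE !cylinder_projE.
  by case: ifP => // ->.
- move=> a; apply: bop_ell2P => f x; rewrite !bop_cmulE letter_isomE.
  rewrite [RHS]letter_isomE; case: ifPn => // /set_mem xa.
  rewrite letter_isom_starE (mem_set (tail_starts_with xa)) letter_isomE.
  by rewrite (tailK xa) mem_set.
- move=> A A' BA BA'; apply: bop_ell2P => f x.
  rewrite bop_cmulE !cylinder_projE cylinderI// in_setI.
  by case: (x \in cylinder B A).
- move=> A A' BA BA'; apply: bop_ell2P => f x.
  have -> : (q A + q A' - q (A `&` A')) f x =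
    q A f x + q A' f x - q (A `&` A') f x by [].
  rewrite !cylinder_projE cylinderI// cylinderU// in_setU.
  rewrite (in_setI x (cylinder B A) (cylinder B A')).
  case: (x \in cylinder B A); case: (x \in cylinder B A');
    rewrite /= ?addrK ?add0r ?subr0; reflexivity.
- move=> _; apply: bop_ell2P => f x.
  by rewrite cylinder_projE cylinder0 in_set0.
- move=> A a BA; apply: bop_ell2P => f x.
  rewrite !bop_cmulE cylinder_projE !letter_isomE cylinder_projE.
  have [xa|xa] := boolP (x \in starts_with B a); last by rewrite if_same.
  by rewrite (mem_cylinder_tail BA (set_mem xa)).
- move=> a; apply: bop_ell2P => f x.
  rewrite bop_cmulE letter_isom_starE cylinder_projE.
  case: ifPn => // /set_mem xa; rewrite letter_isomE prependK mem_set//.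
  exact: prepend_cylinder.
- move=> a b ba; apply: bop_ell2P => f x; rewrite bop_cmulE letter_isom_starE.
  case: ifPn => // /set_mem xb; rewrite letter_isomE.
  case: ifPn => // xa; case: ba.
  by apply: starts_with_inj xa; apply/mem_set/prepend_cylinder.
- move=> A BA An0 finA sinkA; apply: bop_ell2P => f x.
  have rA : regular B A by [].
  rewrite fsbig_finite// bop_ell2_sumE cylinder_projE.
  under eq_bigr => a _ do rewrite letter_range_projE//.
  case: ifPn => xA; last by rewrite big1.
  have [a aA xa] := cylinder_regular rA (set_mem xA).
  rewrite (bigD1_seq (a : {classic letter G}))/= ?fset_uniq//; last first.
    by rewrite in_fset_set// mem_set.
  rewrite mem_set//= big1 ?addr0// => b ba; case: ifPn => // xb.
  by move: ba; rewrite (starts_with_inj xb (mem_set xa)) eqxx.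
Qed.

(** [s_beta^*] removes the prefix [beta] of a path, so evaluation at [x]
    becomes evaluation at the prefixed path. *)
Lemma semigroup_elt_right A beta f x : B A ->
  labels_star beta -> A `<=` word_range beta -> cylinder B A x ->
  semigroup_elt q t [::] A beta f x = f (prepend_word B beta x).
Proof.
move=> BA; elim: beta f => [|b beta IH] f bl Ab xA.
  by rewrite -[LHS]/(q A f x) cylinder_projE mem_set.
rewrite -[LHS]/(semigroup_elt q t [::] A beta (cstar (t b) f) x).
rewrite IH//; last 2 first.
- exact: labels_star_behead bl.
- by apply: subset_trans Ab _; exact: word_range_behead.
by rewrite letter_isom_starE mem_set//; exact: prepend_word_in_range xA.
Qed.

(** [s_alpha] puts the prefix [alpha] in front of a path. *)
Lemma semigroup_elt_left alpha A beta f x : B A ->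
  labels_star alpha -> A `<=` word_range alpha -> cylinder B A x ->
  semigroup_elt q t alpha A beta f (prepend_word B alpha x) =
  semigroup_elt q t [::] A beta f x.
Proof.
move=> BA; elim: alpha => [//|a alpha IH] al Aa xA.
rewrite -[LHS]/(t a (semigroup_elt q t alpha A beta f)
  (prepend B a (prepend_word B alpha x))) letter_isomE mem_set; last first.
  by apply: prepend_cylinder => //; exact: prepend_word_in_range xA.
rewrite prependK IH//.
- exact: labels_star_behead al.
- by apply: subset_trans Aa _; exact: word_range_behead.
Qed.

Lemma delta_square_summable x :
  (fun y => if y \in [set x] then 1 else 0) \in @square_summable R X.
Proof.
rewrite inE/= /rsummable.
have -> : (fun y : X =>
    `|(@sqn R \o (fun y => if y \in [set x] then 1 else 0)) y|%:E) =
    (fun y => if y \in [set x] then 1%:E else 0%E).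
  apply/funext => y /=; case: ifP; last by rewrite sqn0 normr0.
  by rewrite /sqn /= expr1n expr0n/= addr0 normr1.
by rewrite -esum_mkcond esum_set1// ltry.
Qed.

(** The basis vector at the path [x] prefixed by [beta] is sent to a vector
    that has the value 1 at [x] prefixed by [alpha]. *)
Lemma semigroup_elt_neq0 alpha A beta :
  labelled_semigroup B (Some (alpha, A, beta)) ->
  exists f, semigroup_elt q t alpha A beta f != 0.
Proof.
move=> [al bl [BA Aa] [_ Ab] A0].
have [x xA] : cylinder B A !=set0.
  by apply: cylinder_nonempty => //; apply/set0P/eqP.
pose d : H := Ell2 (delta_square_summable (prepend_word B beta x)).
exists d; apply/eqP => e.
have : semigroup_elt q t alpha A beta d (prepend_word B alpha x) = 0.
  by rewrite e.
rewrite semigroup_elt_left// semigroup_elt_right// /d /= mem_set//.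
by move/eqP; rewrite oner_eq0.
Qed.

End BoundaryRepresentation.

Lemma star_hom_semigroup_elt (R : realType) (G : labelled_graph)
    (B : set (set (vertex G))) (C D : cstarAlgType R) (phi : {linear C -> D})
    (p : set (vertex G) -> C) (s : letter G -> C)
    (q : set (vertex G) -> D) (t : letter G -> D) alpha A beta :
  is_star_hom phi -> (forall A, B A -> phi (p A) = q A) ->
  (forall a, phi (s a) = t a) -> B A ->
  phi (semigroup_elt p s alpha A beta) = semigroup_elt q t alpha A beta.
Proof.
move=> [phiM phiS] pq st BA; elim: alpha => [|a alpha IH]; last first.
  by rewrite [semigroup_elt _ _ _ _ _]/= phiM st IH.
elim: beta => [|b beta IH]; first exact: pq.
by rewrite [semigroup_elt _ _ _ _ _]/= phiM phiS st IH.
Qed.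

Definition bop_action (R : realType) (H : hilbertType R) (T : bounded_op H) :
  {linear H -> H} := T.

Lemma star_hom_representation (R : realType) (C : cstarAlgType R)
    (H : hilbertType R) (phi : {linear C -> bounded_op H}) : is_star_hom phi ->
  is_star_representation (fun c => bop_action (phi c)).
Proof.
move=> [phiM phiS]; split.
- move=> c; apply/linear_bounded_continuous/linear_boundedP.
  exists `|phi c|; split; first exact: normr_real.
  move=> M cM x; rewrite (le_trans (bop_norm_bound _ _))// ler_wpM2r// ltW//.
- by move=> k a b x; rewrite linearP.
- by move=> a b x; rewrite phiM.
- by move=> a x y; rewrite phiS; exact: adjP.
Qed.

Theorem theorem5p3 (R : realType) (G : labelled_graph)
    (B : set (set (vertex G)))
    (hB : accommodating B)
    (hwlr : weakly_left_resolving B)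
    (hcompl : closed_rel_compl B)
    (C : cstarAlgType R) (p : set (vertex G) -> C) (s : letter G -> C)
    (huniv : is_universal_algebra B p s) :
  exists (H : hilbertType R) (pi : C -> {linear H -> H}),
    is_star_representation pi /\
    forall (alpha : seq (letter G)) (A : set (vertex G)) (beta : seq (letter G)),
      labelled_semigroup B (Some (alpha, A, beta)) ->
      exists x : H, pi (semigroup_elt p s alpha A beta) x != 0.
Proof.
have [_ /(_ _ _ _ (boundary_relations R hB hwlr))] := huniv.
move=> [[phi [phi_hom phi_p phi_s]] _].
exists (ell2 R {classic boundary_seq G}), (fun c => bop_action (phi c)).
split; first exact: star_hom_representation.
move=> alpha A beta S; have [f nz] := semigroup_elt_neq0 R hB hwlr hcompl S.
exists f; rewrite (star_hom_semigroup_elt _ _ phi_hom phi_p phi_s)//.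
by case: S => _ _ [].
Qed.
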